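(* $$\mathbf{W}(3)=\frac{2}{1-\tau(3)},$$ where $\mathbf{W}(3)=\lim_{n\to\infty}\mathrm{wR}(n,3)$ is the weighted Ramsey limit for $k=3$ and $\tau(3)=\lim_{n\to\infty}\tau(n,3)/\binom{n}{2}$ is the normalized limit of the minimum, over $2$-edge-colorings of $K_n$, of the maximum number of edge-disjoint monochromatic triangles.
   Context: Weighted Ramsey number: for $n\ge 3$, $\mathrm{wR}(n,3)$ is the minimum $q$ such that there is an assignment of nonnegative real weights to the edges of $K_n$ with total sum $\binom{n}{2}$, and a Red/Blue coloring of the edges of the same $K_n$, such that in every complete $3$-vertex subgraph $H$ of $K_n$, the sum of the weights on Red edges of $H$ is at most $q$ and the sum of the weights on Blue edges of $H$ is at most $q$. $\mathbf{W}(3):=\lim_{n\to\infty}\mathrm{wR}(n,3)$ (this limit exists, by monotonicity in $n$ and boundedness). For an edge-coloring $c$ of a complete graph with two colors, $\tau(c,3)$ is the largest number of pairwise edge-disjoint monochromatic triangles in $c$. Let $\tau(n,3):=\min\{\tau(c,3): c \text{ is a } 2\text{-edge-coloring of } K_n\}$ and $\tau(3):=\lim_{n\to\infty}\tau(n,3)/\binom{n}{2}$ (this limit exists, by monotonicity and boundedness). *)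

(* Defs.v *)
From mathcomp Require Import all_boot all_order all_algebra.
From mathcomp Require Import all_classical all_reals all_analysis.

Set Implicit Arguments.
Unset Strict Implicit.
Unset Printing Implicit Defensive.

Import Order.TTheory GRing.Theory Num.Theory.
Import numFieldNormedType.Exports.

Local Open Scope ring_scope.

(* The vertices of K_n are 'I_n, an edge is a 2-element set of
   vertices, and a triangle is given by its 3-element vertex set. *)

Definition edges (n : nat) (A : {set 'I_n}) : {set {set 'I_n}} :=
  [set e : {set 'I_n} | (e \subset A) && (#|e| == 2%N)].

(* true is Red, false is Blue. Only the values on the edges of K_n matter; the
   values on the other vertex sets are never inspected. *)
Definition coloring (n : nat) := {ffun {set 'I_n} -> bool}.

Definition wR_feasible (R : realType) (n : nat) (q : R) : Prop :=
  exists (w : {set 'I_n} -> R) (c : coloring n),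
    [/\ forall e : {set 'I_n}, e \in edges [set: 'I_n] -> 0 <= w e,
        \sum_(e in edges [set: 'I_n]) w e = ('C(n, 2))%:R
      & forall H : {set 'I_n}, #|H| = 3%N ->
          \sum_(e in edges H | c e) w e <= q /\
          \sum_(e in edges H | ~~ c e) w e <= q].

(* The minimum of the feasible q: the feasible lower bound of that set, with
   the junk value 0 should there be none (as for n < 3). *)
Definition wR (R : realType) (n : nat) : R :=
  xget 0 ([set q | wR_feasible n q] `&` lbound [set q | wR_feasible n q])%classic.

Definition W3 (R : realType) : R := limn (@wR R).

Definition monochromatic (n : nat) (c : coloring n) (H : {set 'I_n}) : bool :=
  [exists b : bool, [forall e in edges H, c e == b]].

Definition mono_triangle_packing (n : nat) (c : coloring n)
    (P : {set {set 'I_n}}) : bool :=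
  [forall H in P, (#|H| == 3%N) && monochromatic c H] &&
  [forall H1 in P, [forall H2 in P,
     (H1 != H2) ==> [disjoint edges H1 & edges H2]]].

Definition tau_coloring (n : nat) (c : coloring n) : nat :=
  \max_(P : {set {set 'I_n}} | mono_triangle_packing c P) #|P|.

(* The coloring [ffun=> true] is only the default witness required by arg min;
   c ranges over all colorings. *)
Definition tau (n : nat) : nat :=
  tau_coloring
    [arg min_(c < ([ffun=> true] : coloring n)) tau_coloring c]%N.

Definition tau_density (R : realType) (n : nat) : R :=
  (tau n)%:R / ('C(n, 2))%:R.

Definition tau3 (R : realType) : R := limn (@tau_density R).

(* Main.v *)
(* Fix a coloring of K_n and write N = n(n-1)/2. With q = 2, a feasible weighting
   w <= 1 is the same as 1 - y for a fractional cover y of the monochromatic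
   triangles, and the edges of weight above q/2 of a given color form a matching;
   hence 1 - 2/wR(n,3) is, up to O(1/n), the least density of such a cover over
   all colorings. An integral packing is at most any cover, which gives
   tau(n)/N <= 1 - 2/wR(n,3) + O(1/n).

   Conversely, by LP duality every coloring of K_m has a fractional packing of
   density about 1 - 2/wR(m,3). Averaging these packings over all maps
   from K_m to K_n turns them into a fractional packing of K_n in which every
   triangle has weight O(1/n), so that the Rödl nibble rounds it to an integral
   packing of almost the same size. Thus liminf tau(n)/N >= 1 - 2/wR(m,3) for each
   fixed m, and both sequences converge to sup_m (1 - 2/wR(m,3)). No regularity
   lemma is needed because the small weights come from the averaging. *)

Require Import Defs.
From mathcomp Require Import all_boot all_order all_algebra.
From mathcomp Require Import all_classical all_reals all_analysis.
From mathcomp Require Import fintype finset ring lra.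

Set Implicit Arguments.
Unset Strict Implicit.
Unset Printing Implicit Defensive.

Import Order.TTheory GRing.Theory Num.Theory.
Import numFieldNormedType.Exports.

Local Open Scope ring_scope.

(** * Random subsets with independent elements *)

(** The hypergraph to be packed has the edges of $K_n$ as vertices and the monochromatic triangles
    as hyperedges. It is 3-uniform and linear, but nothing makes it regular, so a bite preserves a
    fractional matching instead of degrees: all vertices survive with the same probability, residual
    degrees typically shrink by the same factor, and one common rescaling restores the bound 1. The
    estimates are first and second moments of a product measure. Duality enters up to a factor 1 -
    eta, so a penalized maximum over a finite grid can take the place of linear programming.
    Sampling uses all maps from K_m to K_n, injective or not: coordinates are then independent and
    counts are products, while a given edge collapses with probability 1/n. *)

Section RandomSubset.

Variables (R : realFieldType) (I : finType) (q : I -> R).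
Hypothesis q01 : forall i, 0 < q i <= 1.

(** [q i] is the probability that [i] is left out, so this is the probability that the random set
    misses [A]. *)
Definition avoidance (A : {set I}) : R := \prod_(i in A) q i.

Lemma avoidance_gt0 A : 0 < avoidance A.
Proof. by apply: prodr_gt0 => i _; case/andP: (q01 i). Qed.

Lemma avoidance_le1 A : avoidance A <= 1.
Proof. by apply: prodr_ile1 => i; case/andP: (q01 i) => /ltW-> ->. Qed.

(** Joint avoidance exceeds the product by exactly the factor [1 / avoidance (A :&: B)]; this does
    the work of a correlation inequality. *)
Lemma avoidanceUI (A B : {set I}) :
  avoidance (A :|: B) * avoidance (A :&: B) = avoidance A * avoidance B.
Proof.
rewrite /avoidance [\prod_(i in A :|: B) _](big_setID A) /= setIUl setIid.
rewrite [\prod_(i in B) _](big_setID A) /= setDUl setDv set0U.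
by rewrite (setUidPl (subsetIr B A)) setIC mulrAC mulrA.
Qed.

(** The union bound, [1 - q i] being the probability that [i] is chosen. *)
Lemma avoidance_sum (A : {set I}) : 1 - \sum_(i in A) (1 - q i) <= avoidance A.
Proof.
have [n] := ubnP #|A|; elim: n A => // n IHn A leAn.
have [->|[i iA]] := set_0Vmem A; first by rewrite /avoidance !big_set0 subr0.
rewrite /avoidance (big_setD1 i iA) (big_setD1 i iA) /=.
have := IHn (A :\ i); rewrite (cardsD1 i A) iA in leAn; move=> /(_ leAn).
rewrite -/(avoidance _) => IH.
have := avoidance_le1 (A :\ i); have := q01 i; nra.
Qed.

Definition subset_prob (S : {set I}) : R :=
  \prod_i (if i \in S then 1 - q i else q i).

Definition subset_mean (f : {set I} -> R) : R := \sum_S subset_prob S * f S.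

Lemma subset_prob_ge0 S : 0 <= subset_prob S.
Proof.
apply: prodr_ge0 => i _; case/andP: (q01 i) => q0 q1.
by case: ifP => _; rewrite ?subr_ge0 // ltW.
Qed.

Lemma subset_mean_avoid (A : {set I}) :
  subset_mean (fun S => [disjoint S & A]%:R) = avoidance A.
Proof.
transitivity (\prod_i ((1 - q i) * (i \notin A)%:R + q i)).
  rewrite bigA_distr; apply: eq_bigr => S _; rewrite /subset_prob.
  case: (boolP [disjoint S & A]) => [dSA|].
    rewrite mulr1; apply: eq_bigr => i _; case: ifP => // iS.
    by rewrite (disjointFr dSA iS) mulr1.
  rewrite mulr0 => /pred0Pn[i /andP[iS iA]].
  by rewrite (bigD1 i) //= (iS : i \in S) (iA : i \in A) mulr0 mul0r.
rewrite /avoidance [RHS]big_mkcond /=; apply: eq_bigr => i _.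
by case: (i \in A); rewrite ?mulr0 ?add0r // mulr1 subrK.
Qed.

Lemma subset_mean_cst a : subset_mean (fun=> a) = a.
Proof.
rewrite /subset_mean -mulr_suml; have := subset_mean_avoid set0.
rewrite /subset_mean /avoidance big_set0.
under eq_bigr do rewrite disjoint_sym disjoints_subset sub0set mulr1.
by move=> ->; rewrite mul1r.
Qed.

Lemma subset_meanD f g :
  subset_mean (fun S => f S + g S) = subset_mean f + subset_mean g.
Proof. by rewrite -big_split; apply: eq_bigr => S _; rewrite mulrDr. Qed.

Lemma subset_meanZ a f : subset_mean (fun S => a * f S) = a * subset_mean f.
Proof. by rewrite mulr_sumr; apply: eq_bigr => S _; rewrite mulrCA. Qed.

Lemma subset_mean_sum (J : finType) (P : pred J) (f : J -> {set I} -> R) :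
  subset_mean (fun S => \sum_(j | P j) f j S) = \sum_(j | P j) subset_mean (f j).
Proof.
rewrite /subset_mean exchange_big; apply: eq_bigr => S _.
by rewrite mulr_sumr.
Qed.

Lemma le_subset_mean f g : (forall S, f S <= g S) -> subset_mean f <= subset_mean g.
Proof. by move=> fg; apply: ler_sum => S _; rewrite ler_wpM2l ?subset_prob_ge0. Qed.

Lemma subset_mean_attained f : exists S, subset_mean f <= f S.
Proof.
have [S _ maxS] := @arg_maxP _ _ _ (set0 : {set I}) xpredT f isT.
exists S; rewrite -[leRHS]subset_mean_cst.
by apply: le_subset_mean => S'; exact: maxS.
Qed.

End RandomSubset.

(** * The nibble *)

Section Bite.

Variables (R : realFieldType) (V E : finType) (inc : E -> {set V}).
Hypothesis inc3 : forall e, #|inc e| = 3%N.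
Hypothesis inc_linear : forall e f, e != f -> (#|inc e :&: inc f| <= 1)%N.

Variables (U : {set V}) (x : E -> R) (eps delta : R).
Hypothesis x_ge0 : forall e, 0 <= x e.
Hypothesis x_le : forall e, x e <= eps.
Hypothesis x_supp : forall e, 0 < x e -> inc e \subset U.
Hypothesis x_deg : forall v, \sum_(e | v \in inc e) x e <= 1.
Hypothesis params : [/\ 0 < delta, delta <= 1 / 2, 0 <= eps & eps <= 1].

Let s : R := 1 - delta.
Let keep e : R := 1 - delta * x e.

(* Hyperedge [e] is selected with probability [delta * x e]; the extra coin of a
   vertex [v] makes [v] survive (no hyperedge through [v] selected, no coin) with
   probability exactly [1 - delta]. *)
Definition keep_prob (i : E + V) : R :=
  match i with
  | inl e => keep e
  | inr v => s / \prod_(e | v \in inc e) keep e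
  end.
Local Notation q := keep_prob.

(** The choices that destroy a vertex of [F]: a hyperedge meeting [F], or the coin of one of its
    vertices. *)
Definition hits (F : {set V}) : {set E + V} :=
  [set i | match i with
           | inl e => ~~ [disjoint inc e & F]
           | inr v => v \in F
           end].

Lemma keep01 e : 0 < keep e <= 1.
Proof.
have [d0 d2 e0 e1] := params.
rewrite /keep; have x0 := x_ge0 e; have x1 := x_le e.
have : delta * x e <= 1 / 2 * 1 by apply: ler_pM => //; lra.
have : 0 <= delta * x e by rewrite mulr_ge0 // ltW.
by lra.
Qed.

Lemma prod_keep_gt0 (P : pred E) : 0 < \prod_(e | P e) keep e.
Proof. by apply: prodr_gt0 => e _; case/andP: (keep01 e). Qed.

Lemma prod_keep_ge (P : pred E) :
  1 - delta * \sum_(e | P e) x e <= \prod_(e | P e) keep e.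
Proof.
have := avoidance_sum keep01 [set e | P e]; rewrite /avoidance.
have PE : (fun e => e \in [set e | P e]) =1 P by move=> e; rewrite inE.
rewrite (eq_bigl _ _ PE) [X in 1 - X](eq_bigl _ _ PE).
by under eq_bigr do rewrite /keep subKr; rewrite mulr_sumr.
Qed.

(** The coin has a genuine probability: the degree of [v] is at most 1, so by the union bound the
    denominator is at least [s]. *)
Lemma keep_prob01 i : 0 < q i <= 1.
Proof.
have [d0 d2 e0 e1] := params.
have s_gt0 : 0 < s by rewrite /s; lra.
case: i => [e|v] /=; first exact: keep01.
rewrite divr_gt0 ?prod_keep_gt0 //= ler_pdivrMr ?prod_keep_gt0 // mul1r.
apply: le_trans (prod_keep_ge _); rewrite lerD2l lerN2.
by rewrite ler_piMr ?(ltW d0) ?x_deg.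
Qed.

Lemma hitsU F G : hits (F :|: G) = hits F :|: hits G.
Proof.
apply/setP => -[e|v]; rewrite !inE //.
by rewrite -negb_and -!setI_eq0 setIUr setU_eq0.
Qed.

Lemma avoid_hits1 v : avoidance q (hits [set v]) = s.
Proof.
have [d0 d2 e0 e1] := params.
rewrite /avoidance big_sumType /=.
rewrite (eq_bigl (fun e => v \in inc e)); last first.
  by move=> e; rewrite inE disjoint_sym disjoints1 negbK.
rewrite (big_pred1 v) => [|w]; last by rewrite !inE.
by rewrite /= mulrC divfK ?gt_eqF ?prod_keep_gt0.
Qed.

Lemma codegree_le v w : v != w ->
  \sum_(e | (v \in inc e) && (w \in inc e)) x e <= eps.
Proof.
have [d0 d2 e0 e1] := params.
move=> vw; case: (pickP (fun e => (v \in inc e) && (w \in inc e))) => [e Pe|P0].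
  rewrite (bigD1 e) //= big1 ?addr0 ?x_le // => f /andP[/andP[vf wf] fe].
  case/andP: Pe => ve we.
  have /subset_leq_card: [set v; w] \subset inc f :&: inc e.
    by apply/subsetP => u /set2P[]->; rewrite inE ?vf ?wf ?ve.
  by rewrite cards2 vw => /leq_trans/(_ (inc_linear fe)).
by rewrite big_pred0.
Qed.

(** As [v] is outside [F], no coin is shared; what remains are hyperedges joining [v] to [F], at
    most one codegree per vertex of [F]. *)
Lemma overlap_le v (F : {set V}) : v \notin F ->
  \sum_(i in hits [set v] :&: hits F) (1 - q i) <= #|F|%:R * eps.
Proof.
have [d0 d2 e0 e1] := params.
move=> vF; rewrite big_sumType /= [X in _ + X]big_pred0 ?addr0; last first.
  by move=> w; rewrite !inE; apply/negP => /andP[/eqP->]; apply/negP.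
rewrite mulr_natl -sumr_const.
apply: le_trans (ler_sum _ _); last first.
  by move=> w wF; apply: (@codegree_le v w); apply: contraNneq vF => ->.
rewrite (exchange_big_dep (fun e => v \in inc e)) /=; last by move=> w e _ /andP[].
rewrite big_mkcond [leRHS]big_mkcond /=; apply: ler_sum => e _.
rewrite !inE disjoint_sym disjoints1 negbK; case: (v \in inc e) => //=.
case: ifPn => [/pred0Pn[w /andP[/= ew wF]]|_]; last by apply: sumr_ge0.
rewrite (bigD1 w) /=; last by rewrite wF.
have d1 : delta <= 1 by lra.
rewrite /keep subKr ler_wpDr ?sumr_ge0 //.
by rewrite ler_piMl.
Qed.

(** Distinct vertices survive almost independently. Adding a vertex to a set of size k multiplies
    the probability by [s], up to the overlap of the hit sets, at most k * eps. *)
Lemma avoid_hits_bounds (F : {set V}) :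
  s ^+ #|F| <= avoidance q (hits F) <= s ^+ #|F| + (#|F| ^ 2)%:R * eps.
Proof.
have [d0 d2 e0 e1] := params.
have [n] := ubnP #|F|; elim: n F => // n IHn F leFn.
have [->|[v vF]] := set_0Vmem F.
  rewrite cards0 expr0 (_ : hits set0 = set0); last first.
    by apply/setP => -[e|v]; rewrite !inE // -setI_eq0 setI0 eqxx.
  by rewrite /avoidance big_set0; lra.
have := IHn (F :\ v); rewrite (cardsD1 v F) vF in leFn *.
move=> /(_ leFn).
have -> : hits F = hits [set v] :|: hits (F :\ v) by rewrite -hitsU setD1K.
set G := F :\ v; have vG : v \notin G by rewrite !inE eqxx.
set k := #|G|; rewrite /= add1n exprS.
move=> /andP[geG leG].
have := avoidanceUI q (hits [set v]) (hits G); rewrite avoid_hits1.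
have [I1 U1 U0] : [/\ avoidance q (hits [set v] :&: hits G) <= 1,
   avoidance q (hits [set v] :|: hits G) <= 1 &
   0 < avoidance q (hits [set v] :|: hits G)].
  by split; first [exact: avoidance_le1 keep_prob01 _ | exact: avoidance_gt0 keep_prob01 _].
have := avoidance_sum keep_prob01 (hits [set v] :&: hits G).
have := overlap_le vG; rewrite -/k.
move: (\sum_(i in _) _) I1 U1 U0 => a.
move: (avoidance q (_ :|: _)) (avoidance q (_ :&: _)) => aU aI I1 U1 U0.
move=> ak aIa aUI.
have s01 : 0 < s <= 1 by rewrite /s; lra.
have k2 : ((k.+1 ^ 2)%:R : R) = (k ^ 2)%:R + k%:R + k%:R + 1.
  by rewrite !natrX -[k.+1]addn1 natrD; ring.
have Uk : aU * (1 - aI) <= k%:R * eps.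
  apply: le_trans (_ : 1 - aI <= _); last by lra.
  by rewrite ler_piMl ?subr_ge0.
have sG : s * s ^+ k <= s * avoidance q (hits G) by rewrite ler_pM2l //; lra.
have sG' : s * avoidance q (hits G) <= s * s ^+ k + (k ^ 2)%:R * eps.
  apply: le_trans (_ : s * (s ^+ k + (k ^ 2)%:R * eps) <= _).
    by rewrite ler_pM2l //; lra.
  rewrite mulrDr lerD2l ler_piMl ?mulr_ge0 //; lra.
have aUI' : aU * aI <= aU by rewrite ler_piMr // ltW.
have ke : 0 <= k%:R * eps by rewrite mulr_ge0.
rewrite k2; apply/andP; split; first by lra.
by move: Uk; rewrite mulrBr mulr1; lra.
Qed.

Let survives (F : {set V}) (S : {set E + V}) := [disjoint S & hits F].
Local Notation Ex := (subset_mean q).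

(** Survival of [v] itself is left out: this is the degree that [v] has in case it survives, and
    each hyperedge asks for two further survivals. *)
Definition residual_degree (v : V) (S : {set E + V}) : R :=
  \sum_(e | v \in inc e) x e * (survives (inc e :\ v) S)%:R.

Let degree v : R := \sum_(e | v \in inc e) x e.

Lemma card_incD1 e v : v \in inc e -> #|inc e :\ v| = 2%N.
Proof. by move=> ve; have := inc3 e; rewrite (cardsD1 v) ve => -[]. Qed.

Lemma residual_degree_mean v : s ^+ 2 * degree v <= Ex (residual_degree v).
Proof.
rewrite subset_mean_sum mulr_sumr; apply: ler_sum => e ve.
rewrite subset_meanZ (subset_mean_avoid q) mulrC ler_wpM2l //.
by case/andP: (avoid_hits_bounds (inc e :\ v)) => + _; rewrite card_incD1.
Qed.

(** Two distinct hyperedges through [v] share no other vertex, so a pair asks for four survivals.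
    The 17 is 4^2 from the error for four vertices plus 1 from the diagonal, where the sum of the
    squares of [x] is at most [eps]. *)
Lemma residual_degree_sqr v :
  Ex (fun S => residual_degree v S ^+ 2) <= s ^+ 4 * degree v ^+ 2 + 17 * eps.
Proof.
have [d0 d2 e0 e1] := params.
have deg0 : 0 <= degree v by apply: sumr_ge0.
have deg1 : degree v <= 1 by exact: x_deg.
have pair e f : v \in inc e -> v \in inc f ->
    avoidance q (hits ((inc e :\ v) :|: (inc f :\ v))) <=
    (s ^+ 4 + 16 * eps) + (e == f)%:R.
  move=> ve vf; have [ef|/inc_linear] := eqVneq e f.
    apply: le_trans (_ : 1 <= _); first exact: avoidance_le1 keep_prob01 _.
    have s4 : 0 <= s ^+ 4 by rewrite exprn_ge0 // /s; lra.
    by rewrite lerDr; lra.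
  rewrite addr0 (cardsD1 v) inE ve vf add1n ltnS leqn0 => /eqP I0.
  case/andP: (avoid_hits_bounds (inc e :\ v :|: inc f :\ v)) => _.
  by rewrite cardsU -setDIl I0 !card_incD1.
have -> : Ex (fun S => residual_degree v S ^+ 2) =
    \sum_(e | v \in inc e) \sum_(f | v \in inc f)
      x e * x f * avoidance q (hits ((inc e :\ v) :|: (inc f :\ v))).
  transitivity (Ex (fun S => \sum_(e | v \in inc e) \sum_(f | v \in inc f)
      x e * x f * (survives ((inc e :\ v) :|: (inc f :\ v)) S)%:R)).
    apply: eq_bigr => S _; congr (_ * _).
    rewrite expr2 big_distrlr; apply: eq_bigr => e _; apply: eq_bigr => f _ /=.
    rewrite mulrACA -natrM mulnb /survives hitsU; congr (_ * (nat_of_bool _)%:R).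
    by rewrite -!setI_eq0 setIUr setU_eq0.
  rewrite subset_mean_sum; apply: eq_bigr => e _.
  rewrite subset_mean_sum; apply: eq_bigr => f _.
  by rewrite subset_meanZ (subset_mean_avoid q).
apply: le_trans (_ : \sum_(e | v \in inc e) \sum_(f | v \in inc f)
   (x e * x f * (s ^+ 4 + 16 * eps) + x e * x f * (e == f)%:R) <= _).
  apply: ler_sum => e ve; apply: ler_sum => f vf.
  by rewrite -mulrDr ler_wpM2l ?mulr_ge0 ?pair.
have -> : \sum_(e | v \in inc e) \sum_(f | v \in inc f)
   (x e * x f * (s ^+ 4 + 16 * eps) + x e * x f * (e == f)%:R) =
   degree v ^+ 2 * (s ^+ 4 + 16 * eps) + \sum_(e | v \in inc e) x e * x e.
  rewrite expr2 big_distrlr mulr_suml -big_split; apply: eq_bigr => e ve /=.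
  rewrite mulr_suml big_split; congr (_ + _).
  rewrite (bigD1 e) //= eqxx mulr1 big1 ?addr0 // => f /andP[_ fe].
  by rewrite eq_sym (negPf fe) mulr0.
have : \sum_(e | v \in inc e) x e * x e <= eps * degree v.
  by rewrite mulr_sumr; apply: ler_sum => e _; rewrite ler_wpM2r.
have : eps * degree v <= eps by rewrite ler_piMr.
have : degree v ^+ 2 * eps <= eps by rewrite ler_piMl // exprn_ile1.
by lra.
Qed.

(** The centre is not the exact mean; the cross term carries a minus sign, so the lower bound on the
    mean controls it. *)
Lemma residual_degree_variance v :
  Ex (fun S => (residual_degree v S - s ^+ 2 * degree v) ^+ 2) <= 17 * eps.
Proof.
have [d0 d2 e0 e1] := params.
have deg0 : 0 <= degree v by apply: sumr_ge0.
set a := s ^+ 2 * degree v.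
have -> : Ex (fun S => (residual_degree v S - a) ^+ 2) =
   Ex (fun S => residual_degree v S ^+ 2) - 2 * a * Ex (residual_degree v) + a ^+ 2.
  transitivity (Ex (fun S => residual_degree v S ^+ 2 +
      ((- (2 * a)) * residual_degree v S + a ^+ 2))).
    by apply: eq_bigr => S _; congr (_ * _); ring.
  by rewrite 2!subset_meanD subset_meanZ subset_mean_cst mulNr addrA.
have a0 : 0 <= a by rewrite mulr_ge0 // exprn_ge0 // /s; lra.
have := residual_degree_sqr v; have := residual_degree_mean v.
rewrite -/a => h1; have : a * a <= a * Ex (residual_degree v) by rewrite ler_wpM2l.
have -> : s ^+ 4 * degree v ^+ 2 = a ^+ 2 by rewrite /a; ring.
by lra.
Qed.

Variable gamma : R.
Hypothesis gamma_gt0 : 0 < gamma.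
Let t : R := s ^+ 2 + gamma.

Definition overfull (S : {set E + V}) : {set V} := [set v | t < residual_degree v S].

Lemma overfull_prob v :
  Ex (fun S => (v \in overfull S)%:R) <= 17 * eps / gamma ^+ 2.
Proof.
have [d0 d2 e0 e1] := params.
rewrite ler_pdivlMr ?exprn_gt0 // mulrC -subset_meanZ.
apply: le_trans (residual_degree_variance v); apply: (le_subset_mean keep_prob01) => S.
rewrite inE; case: ltP => [tv|_]; last by rewrite mulr0 sqr_ge0.
have : s ^+ 2 * degree v <= s ^+ 2.
  by rewrite ler_piMr ?x_deg // exprn_ge0 // /s; lra.
have := gamma_gt0; move: tv; rewrite /t mulr1 => tv g0 le.
by rewrite ler_sqr ?nnegrE; lra.
Qed.

(** Division by [t] undoes the typical shrinking of degrees; dropping the hyperedges at overfull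
    vertices makes the degree bound hold for every [S]. *)
Definition residual (S : {set E + V}) (e : E) : R :=
  if survives (inc e) S && [disjoint inc e & overfull S] then x e / t else 0.

Lemma threshold_gt0 : 0 < t.
Proof. by rewrite /t ltr_wpDl // sqr_ge0. Qed.

Lemma residual_ge0 S e : 0 <= residual S e.
Proof. by rewrite /residual; case: ifP => // _; rewrite divr_ge0 // ltW ?threshold_gt0. Qed.

Lemma residual_le S e : residual S e <= 4 * eps.
Proof.
have [d0 d2 e0 e1] := params; have t0 := threshold_gt0.
rewrite /residual; case: ifP => _; last by lra.
rewrite ler_pdivrMr //; apply: le_trans (x_le e) _.
have : (1 / 2) ^+ 2 <= s ^+ 2 by rewrite ler_sqr ?nnegrE /s; lra.
by rewrite mulrAC => le; rewrite ler_peMl //; have := gamma_gt0; rewrite /t; lra.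
Qed.

Lemma residual_deg S v : \sum_(e | v \in inc e) residual S e <= 1.
Proof.
have t0 := threshold_gt0.
case: (boolP (v \in overfull S)) => [vB|vB].
  rewrite big1 ?ler01 // => e ve; rewrite /residual; case: ifP => // /andP[_ dB].
  by rewrite (disjointFr dB ve) in vB.
apply: le_trans (_ : residual_degree v S / t <= _); last first.
  by rewrite ler_pdivrMr // mul1r; rewrite inE -leNgt in vB.
rewrite mulr_suml; apply: ler_sum => e ve; rewrite /residual.
case: ifP => [/andP[sv _]|_]; last first.
  by rewrite mulr_ge0 ?mulr_ge0 ?ler0n // invr_ge0 ltW.
rewrite (_ : survives (inc e :\ v) S) ?mulr1 //.
move: sv; rewrite /survives -{1}(setD1K ve) hitsU -!setI_eq0 setIUr setU_eq0.
by case/andP.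
Qed.

(** A hyperedge dropped because of overfull vertices is charged to them. A vertex is charged at most
    its degree, hence at most 1, and only vertices of [U] carry weight. *)
Lemma residual_sum S :
  (\sum_e x e * (survives (inc e) S)%:R - \sum_(v in U) (v \in overfull S)%:R) / t
    <= \sum_e residual S e.
Proof.
have t0 := threshold_gt0.
rewrite ler_pdivrMr // mulr_suml lerBlDr.
apply: le_trans (_ : \sum_e (residual S e * t +
   \sum_(v in inc e) x e * (v \in overfull S)%:R) <= _).
  apply: ler_sum => e _; rewrite /residual.
  case: (survives _ _); last first.
    by rewrite mul0r mulr0 add0r sumr_ge0 // => v _; rewrite mulr_ge0.
  case: ifPn => [_|/pred0Pn[v /andP[/= ve vB]]].
    rewrite divfK ?gt_eqF // mulr1 lerDl sumr_ge0 // => v _.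
    by rewrite mulr_ge0.
  rewrite mul0r add0r mulr1 (bigD1 v) //= vB mulr1 lerDl sumr_ge0 // => w _.
  by rewrite mulr_ge0.
rewrite big_split lerD2l /= (exchange_big_dep predT) //=.
rewrite [leRHS]big_mkcond /=; apply: ler_sum => v _.
rewrite -mulr_suml; case: ifPn => vU.
  by rewrite ler_piMl.
rewrite big1 ?mul0r // => e ve; apply/eqP; rewrite eq_le x_ge0 andbT leNgt.
by apply: contra vU => /x_supp/subsetP/(_ v ve).
Qed.

Definition neighbours (e : E) : {set E + V} :=
  [set i | match i with
           | inl f => (f != e) && ~~ [disjoint inc f & inc e]
           | inr _ => false
           end].

(** Positivity is demanded because [S] is later picked by averaging and may itself have probability
    zero. *)
Definition isolated (S : {set E + V}) : {set E} :=
  [set e | [&& 0 < x e, inl e \in S & [disjoint S & neighbours e]]].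

(** Independently of the selection of [e], no neighbour is selected with probability at least
    [1 - 3 * delta], as the three vertices of [e] have degree at most 1 each. *)
Lemma isolated_prob e :
  delta * (1 - 3 * delta) * x e <= Ex (fun S => (e \in isolated S)%:R).
Proof.
have [d0 d2 e0 e1] := params.
have [xe|] := ltP 0 (x e); last first.
  move=> xe; have -> : x e = 0 by apply/eqP; rewrite eq_le xe x_ge0.
  rewrite mulr0 -[leLHS](subset_mean_cst q); apply: (le_subset_mean keep_prob01) => S.
  by rewrite ler0n.
set N := neighbours e; have eN : inl e \notin N by rewrite inE eqxx.
have -> : Ex (fun S => (e \in isolated S)%:R) =
    avoidance q N - avoidance q (inl e |: N).
  transitivity (Ex (fun S => [disjoint S & N]%:R +
      (- 1) * [disjoint S & inl e |: N]%:R)); last first.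
    by rewrite subset_meanD subset_meanZ !(subset_mean_avoid q) mulN1r.
  apply: eq_bigr => S _; congr (_ * _).
  rewrite inE xe /= -!setI_eq0 setIUr setU_eq0.
  rewrite [S :&: [set _] == _]setI_eq0 disjoint_sym disjoints1.
  by case: (inl e \in S); case: (_ == set0); rewrite /=; ring.
have -> : avoidance q (inl e |: N) = keep e * avoidance q N.
  by rewrite /avoidance big_setU1.
have : 1 - 3 * delta <= avoidance q N.
  rewrite /avoidance /N big_sumType /= [X in _ <= _ * X]big_pred0 ?mulr1; last first.
    by move=> v; rewrite inE.
  apply: le_trans (prod_keep_ge _); rewrite lerD2l lerN2 mulrC ler_pM2r //.
  apply: le_trans (_ : \sum_(v in inc e) \sum_(f | v \in inc f) x f <= _).
    rewrite (exchange_big_dep predT) //= big_mkcond /=; apply: ler_sum => f _.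
    rewrite inE; case: ifPn => [/andP[_ /pred0Pn[v /andP[/= vf ve]]]|_].
      by rewrite (bigD1 v) /= ?ve // lerDl sumr_ge0.
    exact: sumr_ge0.
  apply: le_trans (_ : \sum_(v in inc e) 1 <= _); first by apply: ler_sum.
  by rewrite sumr_const inc3.
rewrite -{2}[avoidance q N]mul1r -mulrBl /keep subKr => le.
by rewrite mulrAC ler_wpM2l // mulr_ge0 // ltW.
Qed.

Lemma sum_le_card : 3 * \sum_e x e <= #|U|%:R.
Proof.
rewrite mulr_sumr -sumr_const.
apply: le_trans (_ : \sum_(v in U) \sum_(e | v \in inc e) x e <= _); last first.
  exact: ler_sum.
rewrite (exchange_big_dep predT) //=; apply: ler_sum => e _.
have [xe|] := ltP 0 (x e); last first.
  by move=> xe; rewrite (le_trans _ (sumr_ge0 _ _)) // mulr_ge0_le0.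
rewrite (eq_bigl (mem (inc e))) => [|v]; last first.
  by rewrite /= andb_idl //; move/subsetP: (x_supp xe); apply.
by rewrite sumr_const inc3 mulr_natl.
Qed.

(** One [S] must be good in three respects at once, so they enter a single linear functional whose
    mean is bounded. [d] is the price per vertex of the packing applied afterwards to the
    residual. *)
Lemma bite d : exists S : {set E + V},
  (\sum_e x e) * (delta * (1 - 3 * delta) + s ^+ 3 / t)
    - #|U|%:R * (17 * eps / (gamma ^+ 2 * t) + d * s)
  <= #|isolated S|%:R + \sum_e residual S e
     - d * #|[set v in U | survives [set v] S]|%:R.
Proof.
have t0 := threshold_gt0.
pose f S : R := \sum_e (e \in isolated S)%:R
   + t^-1 * (\sum_e x e * (survives (inc e) S)%:R
             + (- 1) * \sum_(v in U) (v \in overfull S)%:R)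
   + (- d) * \sum_(v in U) (survives [set v] S)%:R.
have [S fS] := subset_mean_attained keep_prob01 f; exists S; apply: le_trans (_ : f S <= _).
  apply: le_trans fS; rewrite /f.
  rewrite !subset_meanD !subset_meanZ !subset_meanD !subset_meanZ.
  rewrite !subset_mean_sum.
  have h1 : delta * (1 - 3 * delta) * \sum_e x e <=
      \sum_e Ex (fun S => (e \in isolated S)%:R).
    by rewrite mulr_sumr; apply: ler_sum => e _; apply: isolated_prob.
  have h2 : s ^+ 3 * \sum_e x e <=
      \sum_e Ex (fun S => x e * (survives (inc e) S)%:R).
    rewrite mulr_sumr; apply: ler_sum => e _.
    rewrite subset_meanZ (subset_mean_avoid q) mulrC ler_wpM2l //.
    by case/andP: (avoid_hits_bounds (inc e)); rewrite inc3.
  have h3 : \sum_(v in U) Ex (fun S => (v \in overfull S)%:R) <=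
      #|U|%:R * (17 * eps / gamma ^+ 2).
    rewrite mulr_natl -sumr_const; apply: ler_sum => v _; exact: overfull_prob.
  have h4 : \sum_(v in U) Ex (fun S => (survives [set v] S)%:R) = #|U|%:R * s.
    rewrite mulr_natl -sumr_const; apply: eq_bigr => v _.
    by rewrite (subset_mean_avoid q) avoid_hits1.
  rewrite h4.
  have h5 : t^-1 * (s ^+ 3 * (\sum_e x e) - #|U|%:R * (17 * eps / gamma ^+ 2)) <=
     t^-1 * ((\sum_e Ex (fun S => x e * (survives (inc e) S)%:R)) +
       -1 * \sum_(v in U) Ex (fun S => (v \in overfull S)%:R)).
    by rewrite ler_pM2l ?invr_gt0 // mulN1r lerB.
  apply: le_trans (lerD (lerD h1 h5) (lexx _)).
  rewrite le_eqVlt; apply/orP; left; apply/eqP; field.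
  by rewrite !gt_eqF.
have count (T : finType) (P Q : pred T) :
    \sum_(i | P i) (Q i)%:R = #|[set i | P i && Q i]|%:R :> R.
  rewrite -sum1_card natr_sum big_mkcond [RHS]big_mkcond; apply: eq_bigr => i _.
  by rewrite inE; case: (P i); case: (Q i).
have isoE : [set i | true & i \in isolated S] = isolated S.
  by apply/setP => e; rewrite inE.
rewrite /f mulN1r !count mulNr lerD2r isoE lerD2l mulrC -count.
exact: residual_sum.
Qed.

Lemma isolated_disjoint S e f : e \in isolated S -> f \in isolated S ->
  e != f -> [disjoint inc e & inc f].
Proof.
rewrite !inE => /and3P[_ eS _] /and3P[_ _ dS] ef.
by have := disjointFr dS eS; rewrite inE ef /= => /negbFE.
Qed.

Lemma isolated_residual S e f : e \in isolated S -> 0 < residual S f ->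
  [disjoint inc e & inc f].
Proof.
rewrite inE /residual => /and3P[_ eS _]; case: ifP => [/andP[sf _] _|]; last first.
  by rewrite ltxx.
by have := disjointFr sf eS; rewrite inE => /negbFE.
Qed.

Lemma residual_supp S e : 0 < residual S e ->
  0 < x e /\ inc e \subset [set v in U | survives [set v] S].
Proof.
rewrite /residual; case: ifP => [/andP[se _]|]; last by rewrite ltxx.
rewrite pmulr_lgt0 ?invr_gt0 ?threshold_gt0 // => xe; split=> //.
apply/subsetP => v ve; rewrite inE (subsetP (x_supp xe)) //=.
move: se; rewrite /survives -{1}(setD1K ve) hitsU -!setI_eq0 setIUr setU_eq0.
by case/andP.
Qed.

End Bite.

(** The loss is charged to [U], the vertices still alive, so that it shrinks with them from bite to
    bite. *)
Definition packable (R : realFieldType) (d eps : R) (V E : finType)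
    (inc : E -> {set V}) : Prop :=
  forall (U : {set V}) (x : E -> R),
    (forall e, 0 <= x e) -> (forall e, x e <= eps) ->
    (forall e, 0 < x e -> inc e \subset U) ->
    (forall v, \sum_(e | v \in inc e) x e <= 1) ->
  exists M : {set E},
    [/\ forall e, e \in M -> 0 < x e,
        forall e f, e \in M -> f \in M -> e != f -> [disjoint inc e & inc f]
      & \sum_e x e - d * #|U|%:R <= #|M|%:R].

(* Uniform in the hypergraph: a linear 3-uniform hypergraph whose fractional
   matching has small weights has a matching losing at most [d] per vertex. *)
Definition nearly_packable (R : realFieldType) (d : R) : Prop :=
  exists2 eps : R, 0 < eps & forall (V E : finType) (inc : E -> {set V}),
    (forall e, #|inc e| = 3%N) ->
    (forall e f, e != f -> (#|inc e :&: inc f| <= 1)%N) ->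
    packable d eps inc.

(* One bite of size [delta = d / 4] leaves a fraction [1 - delta] of the vertices;
   the residual weights, rescaled by about [(1 - delta) ^- 2], are again a
   fractional matching with small weights, to which the hypothesis applies. The
   loss per vertex becomes [d * (1 - delta) + O(delta ^ 2)]. *)
Lemma nearly_packable_step (R : realFieldType) (d : R) :
  0 < d <= 1 -> nearly_packable d -> nearly_packable (d - d ^+ 2 / 8).
Proof.
move=> /andP[d_gt0 d_le1] [eps eps_gt0 pack].
pose delta := d / 4; have dE : d = 4 * delta by rewrite /delta; field.
(* [eps / 4] absorbs the at most fourfold growth of the weights. The sixth power keeps the loss to
   overfull vertices below delta^2 / 2 per vertex: [gamma ^+ 2 * t] is at least delta^4 / 16, and 17
   * 32 < 3^6. *)
pose eps' := Num.min (eps / 4) ((delta / 3) ^+ 6).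
have delta_gt0 : 0 < delta by rewrite /delta; lra.
have delta_le : delta <= 1 / 4 by rewrite /delta; lra.
have eps'_gt0 : 0 < eps' by rewrite lt_min exprn_gt0 divr_gt0.
exists eps' => // V E inc inc3 lin U x x0 xle xsupp xdeg.
have eps'_le1 : eps' <= 1.
  by rewrite ge_min; apply/orP; right; apply: exprn_ile1; lra.
have params : [/\ 0 < delta, delta <= 1 / 2, 0 <= eps' & eps' <= 1].
  by split => //; lra.
pose gamma := delta ^+ 2 / 2; have gammaE : gamma = delta ^+ 2 / 2 by [].
have gamma_gt0 : 0 < gamma by rewrite divr_gt0 ?exprn_gt0.
clearbody gamma.
have [S] := bite inc3 lin x0 xle xsupp xdeg params gamma_gt0 d.
set I := isolated _ _ _; set r := residual _ _ _ _ _; set U' := [set v in U | _].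
move=> le_bite.
have [M [Mpos Mdisj Mcard]] : exists M : {set E},
    [/\ forall e, e \in M -> 0 < r e,
        forall e f, e \in M -> f \in M -> e != f -> [disjoint inc e & inc f]
      & \sum_e r e - d * #|U'|%:R <= #|M|%:R].
  apply: (pack V E inc inc3 lin).
  - by move=> e; apply: residual_ge0.
  - move=> e; apply: le_trans (_ : 4 * eps' <= _); first exact: residual_le.
    have : eps' <= eps / 4 by rewrite ge_min lexx.
    by lra.
  - by move=> e /(residual_supp xsupp gamma_gt0)[].
  - by move=> v; apply: residual_deg => //; exact: params.
have IM e f : e \in I -> f \in M -> [disjoint inc e & inc f].
  by move=> eI /Mpos; apply: isolated_residual eI.
exists (I :|: M); split.
- move=> e /setUP[|/Mpos/(residual_supp xsupp gamma_gt0)[]//].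
  by rewrite inE => /and3P[].
- move=> e f /setUP[] eIM /setUP[] fIM ef.
  + exact: isolated_disjoint eIM fIM ef.
  + exact: IM.
  + by rewrite disjoint_sym; apply: IM.
  + exact: Mdisj.
have -> : #|I :|: M| = (#|I| + #|M|)%N.
  apply/eqP; rewrite (leq_card_setU I M).2 -setI_eq0; apply/eqP/setP => e.
  rewrite in_setI in_set0; apply/negP => /andP[eI eM]; have := IM e e eI eM.
  by rewrite -setI_eq0 setIid -cards_eq0 inc3.
rewrite natrD; have le_card := sum_le_card inc3 x0 xsupp xdeg.
have X0 : 0 <= \sum_e x e by apply: sumr_ge0.
move: le_bite Mcard le_card X0.
move: (\sum_e x e) (\sum_e r e) (#|I|%:R : R) (#|M|%:R : R) (#|U|%:R : R) => X Y i m u.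
set t := (1 - delta) ^+ 2 + gamma => le_bite Mcard le_card X0.
have t_ge : 1 / 4 <= t.
  have : (1 / 2) ^+ 2 <= (1 - delta) ^+ 2 by rewrite ler_sqr ?nnegrE; lra.
  by rewrite /t; lra.
have t0 : 0 < t by lra.
(* With [gamma] equal to 0 the quotient would be [1 - delta]; the slack in [t] costs at most
   [2 * gamma], that is delta^2. *)
have h1 : 1 - delta - 2 * gamma <= (1 - delta) ^+ 3 / t.
  rewrite ler_pdivlMr // -subr_ge0.
  have -> : (1 - delta) ^+ 3 - (1 - delta - 2 * gamma) * t =
    gamma * ((1 - delta) * (1 - 2 * delta) + 2 * gamma) by rewrite /t; ring.
  have p1 : 0 <= 1 - delta by lra.
  have p2 : 0 <= 1 - 2 * delta by lra.
  have g0 := ltW gamma_gt0.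
  by apply: mulr_ge0 => //; apply: addr_ge0; apply: mulr_ge0.
have h2 : 17 * eps' / (gamma ^+ 2 * t) <= delta ^+ 2 / 2.
  rewrite ler_pdivrMr ?mulr_gt0 ?exprn_gt0 //.
  have le' : eps' <= (delta / 3) ^+ 6 by rewrite ge_min lexx orbT.
  have {}le' : eps' <= delta ^+ 6 / 729 by apply: le_trans le' _; rewrite expr_div_n; lra.
  apply: le_trans (_ : delta ^+ 2 / 2 * (gamma ^+ 2 * (1 / 4)) <= _).
    have -> : delta ^+ 2 / 2 * (gamma ^+ 2 * (1 / 4)) = delta ^+ 6 / 32.
      by rewrite gammaE; field.
    by lra.
  by rewrite ler_pM2l ?divr_gt0 ?exprn_gt0 // ler_pM2l ?exprn_gt0.
have h3 : X * (1 - 4 * delta ^+ 2) <=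
    X * (delta * (1 - 3 * delta) + (1 - delta) ^+ 3 / t).
  by rewrite ler_wpM2l //; move: h1; rewrite gammaE; lra.
have u0 : 0 <= u by lra.
have h4 : u * (17 * eps' / (gamma ^+ 2 * t) + d * (1 - delta)) <=
    u * (delta ^+ 2 / 2 + d * (1 - delta)).
  by rewrite ler_wpM2l ?lerD2r.
have h5 : delta ^+ 2 * (3 * X) <= delta ^+ 2 * u.
  by rewrite ler_pM2l ?exprn_gt0.
have h6 : 0 <= delta ^+ 2 * u by rewrite mulr_ge0 ?sqr_ge0.
(* Losses per vertex: 4 delta (1 - delta) from the recursion, delta^2 / 2 from overfull vertices,
   and 4 delta^2 / 3 from [h3] since 3 X <= u. Their sum is at most 4 delta - 2 delta^2 = d - d^2 /
   8. *)
move: h4 Mcard le_bite; rewrite dE; lra.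
Qed.

Lemma nearly_packableW (R : realFieldType) (d d' : R) :
  d <= d' -> nearly_packable d -> nearly_packable d'.
Proof.
move=> dd' [eps eps0 pack]; exists eps => // V E inc inc3 lin U x x0 xle xs xd.
have [M [Mpos Mdisj Mcard]] := pack V E inc inc3 lin U x x0 xle xs xd.
by exists M; split=> //; apply: le_trans Mcard; rewrite lerD2l lerN2 ler_wpM2r.
Qed.

(** The empty matching achieves loss 1. While the current loss [m] exceeds [d], a step lowers it by
    m^2 / 8 >= d^2 / 8, so about 8 / d^2 steps reach [d]. *)
Theorem nibble (R : archiRealFieldType) (d : R) : 0 < d -> nearly_packable d.
Proof.
move=> d0.
have base : nearly_packable (1 : R).
  exists 1 => // V E inc inc3 lin U x x0 xle xs xd; exists set0.
  split=> [e|e f|]; rewrite ?inE // cards0 mul1r.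
  have := sum_le_card inc3 x0 xs xd; have : 0 <= \sum_e x e by apply: sumr_ge0.
  by lra.
have [d1|d1] := leP 1 d; first exact: nearly_packableW base.
have step k : nearly_packable (Num.max d (1 - k%:R * (d ^+ 2 / 8))).
  elim: k => [|k IHk].
    by rewrite mul0r subr0; apply: nearly_packableW base; rewrite le_max lexx orbT.
  set m := Num.max _ _ in IHk; have [md|dm] := leP m d.
    by apply: nearly_packableW IHk; rewrite le_max md.
  have m1 : m <= 1.
    rewrite /m ge_max (ltW d1) /= lerBlDr lerDl mulr_ge0 // divr_ge0 //.
    by rewrite exprn_ge0 // ltW.
  have := nearly_packable_step _ IHk; rewrite m1 (lt_trans d0 dm) => /(_ isT).
  apply: nearly_packableW; rewrite le_max; apply/orP; right.
  have mE : m = 1 - k%:R * (d ^+ 2 / 8).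
    by apply/max_idPr/ltW; move: dm; rewrite lt_max ltxx.
  have : d ^+ 2 <= m ^+ 2 by rewrite ler_sqr ?nnegrE; lra.
  by rewrite -[k.+1%:R]natr1 mulrDl mul1r; lra.
have [k] : exists k : nat, 8 / d ^+ 2 <= k%:R.
  exists (Num.bound (8 / d ^+ 2)); apply/ltW/archi_boundP.
  by rewrite divr_ge0 // sqr_ge0.
have d2 : 0 < d ^+ 2 by rewrite exprn_gt0.
rewrite ler_pdivrMr // => kd; apply: nearly_packableW (step k).
by rewrite ge_max lexx /=; lra.
Qed.

(** * Approximate duality between fractional covers and packings *)

Section Duality.

Variables (R : archiRealFieldType) (V E : finType) (inc : E -> {set V}).
Hypothesis inc3 : forall e, #|inc e| = 3%N.

Implicit Type x : E -> R.

Definition excess x v : R := Num.max 0 (\sum_(e | v \in inc e) x e - 1).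

(** A quadratic penalty replaces the degree constraints. The derivative in [x e] is
    [1 - K * \sum_(v in inc e) excess x v], so stationarity reads as complementary slackness for the
    cover [K * excess x]. *)
Definition penalized (K : R) x : R :=
  \sum_e x e - K / 2 * \sum_v excess x v ^+ 2.

Lemma excess_ge0 x v : 0 <= excess x v.
Proof. by rewrite le_max lexx. Qed.

(** At each of the three vertices of [e] the squared excess grows by at most
    [2 * c * excess x v + c ^+ 2], for [c] of either sign. *)
Lemma penalized_shift K x e c : 0 <= K ->
  penalized K x + c - K * c * \sum_(v in inc e) excess x v - 3 * K / 2 * c ^+ 2
    <= penalized K (fun f => x f + (f == e)%:R * c).
Proof.
move=> K0; pose x' f := x f + (f == e)%:R * c; rewrite -/x'.
have sumE (P : pred E) : \sum_(f | P f) x' f = \sum_(f | P f) x f + (P e)%:R * c.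
  rewrite big_split /=; congr (_ + _); rewrite -mulr_suml; congr (_ * _).
  case Pe : (P e).
    by rewrite (bigD1 e) //= eqxx big1 ?addr0 // => f /andP[_ /negPf->].
  by rewrite big1 // => f Pf; case: eqP => // fe; rewrite -fe Pf in Pe.
have le_excess v : excess x' v ^+ 2 <= excess x v ^+ 2
    + (v \in inc e)%:R * (2 * c * excess x v + c ^+ 2).
  rewrite {1}/excess sumE; set r := \sum_(f | _) x f.
  have ex0 := excess_ge0 x v; have exr : r - 1 <= excess x v.
    by rewrite le_max lexx orbT.
  case: (v \in inc e); last by rewrite !mul0r !addr0 -/(excess x v).
  rewrite !mul1r; have -> : excess x v ^+ 2 + (2 * c * excess x v + c ^+ 2) =
    (excess x v + c) ^+ 2 by ring.
  have [h|h] := leP 0 (r + c - 1); last first.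
    by rewrite expr0n sqr_ge0.
  by rewrite ler_sqr ?nnegrE; lra.
have : \sum_v excess x' v ^+ 2 <= \sum_v excess x v ^+ 2 +
    (2 * c * \sum_(v in inc e) excess x v + 3 * c ^+ 2).
  have -> : 2 * c * \sum_(v in inc e) excess x v + 3 * c ^+ 2 =
    \sum_v (v \in inc e)%:R * (2 * c * excess x v + c ^+ 2).
    rewrite -(inc3 e) [#|_|%:R * _]mulr_natl -sumr_const mulr_sumr -big_split big_mkcond /=.
    by apply: eq_bigr => v _; case: ifP; rewrite ?mul1r ?mul0r.
  by rewrite -big_split; apply: ler_sum => v _; exact: le_excess.
rewrite /penalized sumE mul1r => le.
have : K / 2 * \sum_v excess x' v ^+ 2 <= K / 2 * (\sum_v excess x v ^+ 2 +
    (2 * c * \sum_(v in inc e) excess x v + 3 * c ^+ 2)).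
  by rewrite ler_wpM2l // divr_ge0.
by lra.
Qed.

(* A maximizer of the penalized objective over a grid of mesh [h]: the excesses
   are, up to scaling, an almost complementary fractional cover. *)
Lemma penalized_max (K h : R) : 1 <= K -> 0 < h ->
  exists x, [/\ forall e, 0 <= x e,
    forall e, 1 - 3 * K / 2 * h <= K * \sum_(v in inc e) excess x v
  & forall e, 0 < x e -> K * \sum_(v in inc e) excess x v <= 1 + 3 * K / 2 * h].
Proof.
move=> K1 h0.
(* The grid reaches at least up to 2: a coordinate at its upper end, which cannot be moved up,
   forces excess at least 1 at its vertices, and [1 <= K] then gives the lower bound. *)
have [N hN] : exists N : nat, 2 <= h * N%:R.
  exists (Num.bound (2 / h)); rewrite mulrC -ler_pdivrMr //.
  by apply/ltW/archi_boundP; rewrite divr_ge0 // ltW.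
pose gr (g : {ffun E -> 'I_N.+1}) e : R := h * (g e)%:R.
have [g _ maxg] := @arg_maxP _ _ _ [ffun=> ord0] xpredT (fun g => penalized K (gr g)) isT.
have shift_le (g' : {ffun E -> 'I_N.+1}) e c :
    gr g' =1 (fun f => gr g f + (f == e)%:R * c) ->
    c * (1 - K * \sum_(v in inc e) excess (gr g) v) <= 3 * K / 2 * c ^+ 2.
  move=> gE; have := maxg g' isT; have K0 : 0 <= K by lra.
  have := penalized_shift (gr g) e c K0.
  have -> : penalized K (fun f => gr g f + (f == e)%:R * c) = penalized K (gr g').
    have sE (P : pred E) : \sum_(f | P f) (gr g f + (f == e)%:R * c) = \sum_(f | P f) gr g' f.
      by apply: eq_bigr => f _; rewrite gE.
    by rewrite /penalized sE; congr (_ - _ * _); apply: eq_bigr => v _; rewrite /excess sE.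
  by move=> /= h1 h2; move: (le_trans h1 h2); lra.
exists (gr g); split=> [e|e|e].
- by rewrite mulr_ge0 // ltW.
- have [geN|] := ltP (g e : nat) N; last first.
    move=> Nge; apply: le_trans (_ : 1 <= _).
      by rewrite gerBl mulr_ge0 ?divr_ge0 ?mulr_ge0 //; lra.
    have [v ve] : exists v, v \in inc e by apply/set0Pn; rewrite -cards_eq0 inc3.
    have ex1 : 1 <= excess (gr g) v.
      rewrite le_max; apply/orP; right; rewrite (bigD1 e) //=.
      have : 2 <= gr g e by apply: le_trans hN _; rewrite ler_pM2l // ler_nat.
      have : 0 <= \sum_(f | (v \in inc f) && (f != e)) gr g f.
        by apply: sumr_ge0 => f _; rewrite mulr_ge0 // ltW.
      by lra.
    rewrite (bigD1 v) //=.
    have : 0 <= \sum_(w in inc e | w != v) excess (gr g) w.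
      by apply: sumr_ge0 => w _; exact: excess_ge0.
    move=> s0; apply: le_trans (_ : 1 * 1 <= _); first by rewrite mul1r.
    by apply: ler_pM => //; lra.
  have := @shift_le [ffun f => if f == e then inord (g e).+1 else g f] e h.
  have H : gr [ffun f => if f == e then inord (g e).+1 else g f] =1
      (fun f => gr g f + (f == e)%:R * h).
    move=> f; rewrite /gr ffunE; case: eqP => [->|_]; last by rewrite mul0r addr0.
    by rewrite inordK // mul1r -[(g e).+1%:R]natr1 mulrDr mulr1.
  move=> /(_ H); rewrite expr2 mulrA [_ * h in leRHS]mulrC ler_pM2l //.
  by lra.
- rewrite pmulr_rgt0 // ltr0n => ge0.
  have := @shift_le [ffun f => if f == e then inord (g e).-1 else g f] e (- h).
  have H : gr [ffun f => if f == e then inord (g e).-1 else g f] =1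
      (fun f => gr g f + (f == e)%:R * (- h)).
    move=> f; rewrite /gr ffunE; case: eqP => [->|_]; last by rewrite mul0r addr0.
    rewrite inordK; last by rewrite (leq_ltn_trans (leq_pred _)).
    by rewrite mul1r -[in RHS](prednK ge0) -[(g e).-1.+1%:R]natr1 mulrDr mulr1 addrK.
  move=> /(_ H); rewrite sqrrN expr2 mulrA [_ * h in leRHS]mulrC mulNr -mulrN ler_pM2l //.
  by lra.
Qed.

(** The scaled excesses form a cover, so their sum is at least about [beta]. By complementary
    slackness the sum of [x] is about as large, since the degree is at least 1 wherever the excess
    is positive. A final division by [1 + eta / 4] removes the overload. *)
Lemma approximate_duality (beta eta : R) : 0 <= beta -> 0 < eta <= 1 ->
  (forall y : V -> R, (forall v, 0 <= y v) ->
     (forall e, 1 <= \sum_(v in inc e) y v) -> beta <= \sum_v y v) ->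
  exists x, [/\ forall e, 0 <= x e, forall v, \sum_(e | v \in inc e) x e <= 1
    & (1 - eta) * beta <= \sum_e x e].
Proof.
move=> beta0 /andP[eta0 eta1] cover.
(* [K] brings every excess below [eta / 4], and [h] makes the slack [3 * K / 2 * h] equal to
   [eta / 4]. *)
pose K := 8 / eta; pose h := eta ^+ 2 / 48.
have K8 : 8 <= K by rewrite ler_pdivlMr //; lra.
have h0 : 0 < h by rewrite divr_gt0 ?exprn_gt0.
have [|x [x0 lo up]] := @penalized_max K h _ h0; first by lra.
have th : 3 * K / 2 * h = eta / 4 by rewrite /K /h; field; rewrite gt_eqF.
rewrite th in lo up; set a := excess x in lo up.
have th1 : 0 < 1 - eta / 4 by lra.
have a0 v : 0 <= a v by exact: excess_ge0.
have sum_a : (1 - eta / 4) * beta <= K * \sum_v a v.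
  rewrite mulrC -ler_pdivlMr //.
  have -> : K * (\sum_v a v) / (1 - eta / 4) = \sum_v K * a v / (1 - eta / 4).
    by rewrite mulr_sumr mulr_suml.
  apply: cover => [v|e].
    by apply: divr_ge0; [apply: mulr_ge0 => //; lra | lra].
  by rewrite -mulr_suml -mulr_sumr ler_pdivlMr // mul1r.
have deg_ge v : 0 < a v -> 1 <= \sum_(e | v \in inc e) x e.
  by rewrite lt_max ltxx /= subr_gt0 => /ltW.
have Ka v : K * a v <= 1 + eta / 4.
  have [av|av] := ltP 0 (a v); last first.
    by apply: le_trans (_ : 0 <= _); [rewrite mulr_ge0_le0 //; lra | lra].
  case: (pickP (fun e => (v \in inc e) && (0 < x e))) => [e /andP[ve xe]|none].
    apply: le_trans (up e xe); rewrite ler_pM2l; last by lra.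
    by rewrite (bigD1 v) //= lerDl sumr_ge0.
  have := deg_ge v av; rewrite big1 ?ler10 // => e ve.
  by have := none e; rewrite ve lt_neqAle x0 andbT eq_sym => /negbFE/eqP.
have deg_le v : \sum_(e | v \in inc e) x e <= 1 + eta / 4.
  have : \sum_(e | v \in inc e) x e - 1 <= a v by rewrite le_max lexx orbT.
  have : 8 * a v <= K * a v by rewrite ler_wpM2r.
  have : a v * 8 <= eta * (1 + eta / 4).
    have := Ka v; rewrite /K mulrAC ler_pdivrMr // mulrC => le.
    by rewrite [a v * 8]mulrC [eta * _]mulrC mulrC.
  have : eta * (1 + eta / 4) <= eta * (5 / 4) by rewrite ler_pM2l //; lra.
  by lra.
have swap : \sum_e x e * (K * \sum_(v in inc e) a v) =
    K * \sum_v a v * \sum_(e | v \in inc e) x e.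
  under eq_bigr do rewrite mulrCA mulr_sumr.
  rewrite -mulr_sumr (exchange_big_dep predT) //=; congr (_ * _).
  by apply: eq_bigr => v _; rewrite mulr_sumr; apply: eq_bigr => e _; rewrite mulrC.
have lower : K * \sum_v a v <= \sum_e x e * (1 + eta / 4).
  apply: le_trans (_ : \sum_e x e * (K * \sum_(v in inc e) a v) <= _).
    rewrite swap ler_pM2l; last by lra.
    apply: ler_sum => v _; have [av|av] := ltP 0 (a v).
      by rewrite ler_peMr ?deg_ge.
    have -> : a v = 0 by apply/eqP; rewrite eq_le av a0.
    by rewrite mul0r.
  apply: ler_sum => e _; have [xe|xe] := ltP 0 (x e).
    by rewrite ler_pM2l // up.
  have -> : x e = 0 by apply/eqP; rewrite eq_le xe x0.
  by rewrite !mul0r.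
have c0 : 0 < 1 + eta / 4 by lra.
exists (fun e => x e / (1 + eta / 4)); split=> [e|v|].
- by rewrite divr_ge0 // ltW.
- by rewrite -mulr_suml ler_pdivrMr // mul1r.
rewrite -mulr_suml ler_pdivlMr // -(ler_pM2r c0) [leRHS]mulr_suml.
apply: le_trans lower; apply: le_trans sum_a.
rewrite mulrAC -!mulrA [beta * _]mulrC !mulrA ler_wpM2r //.
have : 0 <= eta ^+ 2 by rewrite sqr_ge0.
have : 0 <= eta ^+ 3 by rewrite exprn_ge0 // ltW.
by lra.
Qed.

End Duality.

(** * Triangle packings, covers and weightings *)

Section Edges.

Variable n : nat.
Implicit Types (A H e f : {set 'I_n}) (c : coloring n).

Lemma in_edges A e : (e \in edges A) = (e \subset A) && (#|e| == 2%N).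
Proof. by rewrite inE. Qed.

Lemma edges_card2 A e : e \in edges A -> #|e| = 2%N.
Proof. by rewrite in_edges => /andP[_ /eqP]. Qed.

Lemma in_edgesT e : (e \in edges [set: 'I_n]) = (#|e| == 2%N).
Proof. by rewrite in_edges subsetT. Qed.

Lemma card_edges A : #|edges A| = 'C(#|A|, 2).
Proof. exact: cards_draws. Qed.

Lemma edges_sub A : edges A \subset edges [set: 'I_n].
Proof. by apply/subsetP => e /edges_card2; rewrite in_edgesT => ->. Qed.

Lemma edgesI A H : edges A :&: edges H = edges (A :&: H).
Proof.
by apply/setP => e; rewrite !inE subsetI; case: (#|e| == _); rewrite ?andbF ?andbT.
Qed.

Lemma edges_linear A H : #|A| = 3%N -> #|H| = 3%N -> A != H ->
  (#|edges A :&: edges H| <= 1)%N.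
Proof.
move=> A3 H3 AH; rewrite edgesI card_edges.
have : (#|A :&: H| <= 2)%N.
  rewrite leqNgt; apply: contra AH => I3.
  have /eqP <- : A :&: H == A by rewrite eqEcard subsetIl A3.
  by rewrite eqEcard subsetIr H3.
by case: #|_| => [|[|[|]]].
Qed.

Lemma monochromaticP c H :
  reflect (exists b, forall e, e \in edges H -> c e = b) (monochromatic c H).
Proof.
apply: (iffP existsP) => -[b hb]; exists b.
  by move=> e eH; apply/eqP; move/forall_inP: hb; apply.
by apply/forall_inP => e eH; rewrite hb.
Qed.

Lemma packingP c (P : {set {set 'I_n}}) : reflect
  [/\ forall H, H \in P -> #|H| = 3%N, forall H, H \in P -> monochromatic c H
    & forall H1 H2, H1 \in P -> H2 \in P -> H1 != H2 -> [disjoint edges H1 & edges H2]]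
  (mono_triangle_packing c P).
Proof.
apply: (iffP andP) => [[/forall_inP PP /forall_inP dP]|[P3 Pm Pd]].
  split=> [H /PP/andP[/eqP] // | H /PP/andP[] // | H1 H2 P1 P2 ne].
  by move/forall_inP/(_ H2 P2)/implyP: (dP H1 P1); apply.
split; first by apply/forall_inP => H PH; rewrite P3 ?eqxx ?Pm.
by apply/forall_inP => H1 P1; apply/forall_inP => H2 P2; apply/implyP; apply: Pd.
Qed.

Lemma tau_coloring_ge c (P : {set {set 'I_n}}) :
  mono_triangle_packing c P -> (#|P| <= tau_coloring c)%N.
Proof. by move=> PP; apply: (bigop.bigmax_sup P). Qed.

Lemma tau_coloring_attained c :
  exists2 P : {set {set 'I_n}}, mono_triangle_packing c P & tau_coloring c = #|P|.
Proof.
have packing0 : mono_triangle_packing c set0.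
  by apply/packingP; split=> [H|H|H1 H2]; rewrite in_set0.
rewrite /tau_coloring (bigop.bigmax_eq_arg set0) //.
by case: arg_maxnP => // P PP _; exists P.
Qed.

Lemma tau_le c : (tau n <= tau_coloring c)%N.
Proof. by rewrite /tau; case: arg_minnP => // c0 _; apply. Qed.

Lemma tau_attained : exists c : coloring n, tau n = tau_coloring c.
Proof. by eexists. Qed.

End Edges.

Section Covers.

Variable R : realType.

Definition mono_cover n (c : coloring n) (y : {set 'I_n} -> R) : Prop :=
  (forall e, 0 <= y e) /\
  forall H : {set 'I_n}, #|H| = 3%N -> monochromatic c H ->
    1 <= \sum_(e in edges H) y e.

Variable n : nat.
Implicit Types (H e f : {set 'I_n}) (c : coloring n).

Lemma packing_le_cover c y : mono_cover c y ->
  (tau_coloring c)%:R <= \sum_(e in edges [set: 'I_n]) y e.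
Proof.
move=> [y0 cov]; have [P /packingP[P3 Pm Pd] ->] := tau_coloring_attained c.
rewrite -sum1_card natr_sum.
apply: le_trans (_ : \sum_(H in P) \sum_(e in edges H) y e <= _).
  by apply: ler_sum => H PH; apply: cov; [apply: P3 | apply: Pm].
rewrite (exchange_big_dep (mem (edges [set: 'I_n]))) /=; last first.
  by move=> H e _; apply/subsetP/edges_sub.
apply: ler_sum => e _.
case: (pickP (fun H => (H \in P) && (e \in edges H))) => [H /andP[PH He]|none].
  rewrite (big_pred1 H) // => H'; apply/andP/eqP => [[PH' H'e]|->//].
  apply/eqP; apply: contraT => ne; have := Pd _ _ PH' PH ne.
  by move/disjointFr/(_ H'e); rewrite He.
by rewrite big_pred0.
Qed.

Lemma edge_in_triangle e : (2 < n)%N -> #|e| = 2%N ->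
  exists2 H : {set 'I_n}, #|H| = 3%N & e \in edges H.
Proof.
move=> n3 e2; have [v ve] : exists v, v \in ~: e.
  by apply/set0Pn; rewrite -cards_eq0 cardsCs setCK card_ord e2 subn_eq0 -ltnNge.
exists (v |: e); last by rewrite in_edges subsetU1 e2.
by rewrite cardsU1 -in_setC ve e2.
Qed.

Lemma disjoint_edges_le (F : {set {set 'I_n}}) :
  (forall e, e \in F -> #|e| = 2%N) ->
  (forall e f, e \in F -> f \in F -> e != f -> [disjoint e & f]) ->
  (#|F| * 2 <= n)%N.
Proof.
move=> F2 Fd; have /eqP Fcov : trivIset F by apply/trivIsetP => e f; apply: Fd.
rewrite -sum_nat_const -[leqRHS]card_ord.
rewrite -(eq_bigr _ (fun e eF => F2 e eF)) Fcov; exact: max_card.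
Qed.

Definition color_sum_le (w : {set 'I_n} -> R) c (q : R) :=
  forall H : {set 'I_n}, #|H| = 3%N ->
  \sum_(e in edges H | c e) w e <= q /\ \sum_(e in edges H | ~~ c e) w e <= q.

Lemma color_sum_leP w c q : color_sum_le w c q <->
  (forall (H : {set 'I_n}) b, #|H| = 3%N -> \sum_(e in edges H | c e == b) w e <= q).
Proof.
split=> [wq H [] H3|wq H H3].
- by rewrite (eq_bigl (fun e => (e \in edges H) && c e)) ?(wq H H3).1 // => e; case: (c e).
- by rewrite (eq_bigl (fun e => (e \in edges H) && ~~ c e)) ?(wq H H3).2 // => e; case: (c e).
- split; [have := wq H true H3 | have := wq H false H3]; congr (_ <= _);
  by apply: eq_bigl => e; case: (c e).
Qed.

(** The cover is [1 - 2 / q * w e] truncated at 0; before truncation it already sums to at least 3 -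
    2 on a monochromatic triangle. The term [n%:R] pays for the truncation. *)
Lemma feasible_tau q : (2 < n)%N -> wR_feasible n q ->
  0 < q /\ (tau n)%:R <= ('C(n, 2))%:R - 2 / q * ('C(n, 2))%:R + n%:R :> R.
Proof.
move=> n3 [w [c [w0 wT wq]]]; have {}wq := (color_sum_leP w c q).1 wq.
have sum_ge (P : pred {set 'I_n}) (H : {set 'I_n}) :
    0 <= \sum_(f in edges H | P f) w f.
  by apply: sumr_ge0 => f /andP[/edges_card2 f2 _]; rewrite w0 // in_edgesT f2.
have w_le e : #|e| = 2%N -> w e <= q.
  move=> e2; have [H H3 eH] := edge_in_triangle n3 e2.
  apply: le_trans (wq H (c e) H3); rewrite (bigD1 e) /=; last by rewrite eH eqxx.
  by rewrite lerDl; under eq_bigl do rewrite -andbA; apply: sum_ge.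
have C0 : 0 < ('C(n, 2))%:R :> R by rewrite ltr0n bin_gt0 ltnW.
have q0 : 0 < q.
  rewrite ltNge; apply: contraTN C0 => q_le0; rewrite -wT -leNgt.
  apply: sumr_le0 => e; rewrite in_edgesT => /eqP e2.
  exact: le_trans (w_le e e2) q_le0.
split=> //; pose y e : R := if #|e| == 2%N then Num.max 0 (1 - 2 / q * w e) else 0.
have cov : mono_cover c y.
  split=> [e|H H3 /monochromaticP[b cH]].
    by rewrite /y; case: ifP => // _; rewrite le_max lexx.
  apply: le_trans (_ : \sum_(e in edges H) (1 - 2 / q * w e) <= _); last first.
    apply: ler_sum => e /edges_card2 e2; rewrite /y e2 eqxx.
    by rewrite le_max lexx orbT.
  rewrite sumrB sumr_const card_edges H3 (_ : 'C(3, 2) = 3%N) // -mulr_sumr.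
  have : 2 / q * \sum_(e in edges H) w e <= 2 / q * q.
    rewrite ler_pM2l ?divr_gt0 //; apply: le_trans (wq H b H3).
    rewrite le_eqVlt; apply/orP; left; apply/eqP; apply: eq_bigl => e.
    by rewrite andb_idr // => eH; rewrite cH.
  by rewrite divfK ?gt_eqF //; lra.
apply: le_trans (_ : (tau_coloring c)%:R <= _); first by rewrite ler_nat tau_le.
apply: le_trans (packing_le_cover cov) _.
(* Two heavy edges of one color sharing a vertex would give that color weight
   above [q] in a triangle, so the heavy edges of each color form a matching. *)
pose heavy b := [set e : {set 'I_n} | [&& #|e| == 2%N, c e == b & q / 2 < w e]].
have heavy_le b : (#|heavy b| * 2 <= n)%N.
  apply: disjoint_edges_le => [e|e f]; rewrite inE => /and3P[/eqP e2 /eqP ce we] //.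
  rewrite inE => /and3P[/eqP f2 /eqP cf wf] ef; rewrite -setI_eq0 -cards_eq0.
  have I2 : (#|e :&: f| <= 2)%N by rewrite -e2 subset_leq_card ?subsetIl.
  have := cardsUI e f; rewrite e2 f2.
  move: I2; rewrite leq_eqVlt => /orP[/eqP I2|].
    have /eqP ee : e :&: f == e by rewrite eqEcard subsetIl I2 e2.
    have /eqP ff : e :&: f == f by rewrite eqEcard subsetIr I2 f2.
    by case/eqP: ef; rewrite -[LHS]ee.
  rewrite ltnS leq_eqVlt => /orP[/eqP I1|]; last by rewrite ltnS leqn0.
  rewrite I1 addn1 => -[U3]; have := wq (e :|: f) b U3.
  rewrite (bigD1 e) /=; last by rewrite in_edges subsetUl e2 ce !eqxx.
  rewrite (bigD1 f) /=; last by rewrite in_edges subsetUr f2 cf !eqxx eq_sym.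
  have : 0 <= \sum_(g | ((g \in edges (e :|: f)) && (c g == b) && (g != e)) && (g != f)) w g.
    by under eq_bigl do rewrite -!andbA; apply: sum_ge.
  by lra.
have heavyN : (#|heavy true|%:R + #|heavy false|%:R : R) <= n%:R.
  rewrite -natrD ler_nat.
  have := leq_add (heavy_le true) (heavy_le false).
  by rewrite -mulnDl addnn -muln2 leq_pmul2r.
(* Truncation changes heavy edges only. As [w e <= q], the untruncated value is at least -1, so
   adding 1 there compensates. *)
apply: le_trans (_ : \sum_(e in edges [set: 'I_n])
   (1 - 2 / q * w e + ((e \in heavy true)%:R + (e \in heavy false)%:R)) <= _).
  apply: ler_sum => e; rewrite in_edgesT => e2; rewrite /y e2 !inE e2 /=.
  have := w_le e (eqP e2) => le_wq; have we := w0 e; rewrite in_edgesT e2 in we.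
  have {}we := we isT; set a := 2 / q * w e.
  have [hw|lw] := ltP (q / 2) (w e); last first.
    rewrite !andbF addr0 ge_max addr0; apply/andP; split; last exact: lexx.
    by rewrite subr_ge0 /a mulrAC ler_pdivrMr // mul1r; lra.
  have -> : ((c e == true) && true)%:R + ((c e == false) && true)%:R = 1 :> R.
    by case: (c e); rewrite /= ?addr0 ?add0r.
  have : a <= 2 by rewrite /a mulrAC ler_pdivrMr //; lra.
  by rewrite ge_max; move=> a2; apply/andP; split; lra.
rewrite big_split sumrB sumr_const card_edges cardsT card_ord -mulr_sumr wT.
rewrite lerD2l big_split /=; apply: le_trans heavyN.
by apply: lerD; rewrite -sum1_card natr_sum [leRHS]big_mkcond [leLHS]big_mkcond /=;
  apply: ler_sum => e _; case: ifP => _; case: ifP => _.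
Qed.

(** Weights proportional to [1 - y e]: a color gets at most 3 - 1 from a monochromatic triangle, and
    otherwise at most two edges of at most 1 each. Truncating [y] at 1 keeps the weights nonnegative
    and the triangles covered. *)
Lemma cover_feasible c y : (2 < n)%N -> mono_cover c y ->
  let Y := \sum_(e in edges [set: 'I_n]) y e in
  Y < ('C(n, 2))%:R ->
  wR_feasible n (2 * ('C(n, 2))%:R / (('C(n, 2))%:R - Y)).
Proof.
move=> n3 [y0 cov] Y YC; set N : R := ('C(n, 2))%:R in YC *.
pose y' e := Num.min 1 (y e); pose Y' := \sum_(e in edges [set: 'I_n]) y' e.
have Y'Y : Y' <= Y by apply: ler_sum => e _; rewrite ge_min lexx orbT.
have N0 : 0 < N by rewrite ltr0n bin_gt0 ltnW.
have NY' : 0 < N - Y' by lra.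
have k0 : 0 < N / (N - Y') by rewrite divr_gt0.
have y'01 e : 0 <= 1 - y' e <= 1.
  by rewrite subr_ge0 ge_min lexx /= gerBl le_min ler01 y0.
exists (fun e => N / (N - Y') * (1 - y' e)), c; split.
- by move=> e _; rewrite mulr_ge0 ?(ltW k0) //; case/andP: (y'01 e).
- rewrite -mulr_sumr sumrB sumr_const card_edges cardsT card_ord -/Y' -/N.
  by rewrite divfK // gt_eqF.
apply/color_sum_leP => H b H3; rewrite -mulr_sumr.
apply: le_trans (_ : N / (N - Y') * 2 <= _); last first.
  rewrite -[leRHS]mulrA [leRHS]mulrC ler_pM2r // ler_pM2l //.
  by rewrite lef_pV2 ?posrE; lra.
rewrite ler_pM2l //; set S := \sum_(e in _ | _) _.
have edges3 : #|edges H| = 3%N by rewrite card_edges H3.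
have [mono|] := boolP [forall e in edges H, c e == b].
  have mH : monochromatic c H by apply/existsP; exists b.
  have S_le : S <= \sum_(e in edges H) (1 - y' e).
    rewrite /S big_mkcondr; apply: ler_sum => e _; case: ifP => // _.
    by case/andP: (y'01 e).
  apply: le_trans S_le _; rewrite sumrB sumr_const edges3.
  have : 1 <= \sum_(e in edges H) y' e.
    have [|none] := boolP [exists e in edges H, 1 <= y e].
      case/exists_inP => e eH ye; rewrite (bigD1 e) //= /y' (min_idPl ye).
      by rewrite lerDl sumr_ge0 // => f _; rewrite le_min ler01 y0.
    apply: le_trans (cov H H3 mH) _; apply: ler_sum => e eH.
    rewrite le_min lexx andbT ltW // ltNge; apply: contra none => ye.
    by apply/exists_inP; exists e.
  by lra.
case/forall_inPn => e eH ceb.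
apply: le_trans (_ : \sum_(f in edges H :\ e) 1 <= _); last first.
  by rewrite sumr_const; move: edges3; rewrite (cardsD1 e) eH add1n => -[->].
rewrite /S big_mkcond [leRHS]big_mkcond; apply: ler_sum => f _.
rewrite in_setD1; have [->|fe] := eqVneq f e; first by rewrite (negPf ceb) andbF.
case: (f \in edges H) => //=; case/andP: (y'01 f) => ge le.
by case: ifP.
Qed.

End Covers.

(** * The minimum defining wR is attained *)

Section Minimum.

Variables (R : realType) (n : nat).
Hypothesis n_gt2 : (2 < n)%N.

Let N : R := ('C(n, 2))%:R.

(* The coordinate [None] carries the bound [q], the others carry the weights. *)
Let point := prod_topology (fun _ : option {set 'I_n} => (R : topologicalType)).

Let N_ge1 : 1 <= N.
Proof. by rewrite /N ler1n bin_gt0 ltnW. Qed.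

Let box (i : option {set 'I_n}) : set R :=
  (if i is Some _ then `[0, N] else `[0, 3])%classic.

Let bounded_points : set point := [set g : point | forall i, box i (g i)]%classic.

Let admissible (c : coloring n) : set point :=
  ([set g : point | (\sum_(e in edges [set: 'I_n]) g (Some e) = N)%R] `&`
   \bigcap_(Hb in [set Hb : {set 'I_n} * bool | #|Hb.1| = 3%N])
     [set g : point |
       (\sum_(e in edges Hb.1 | c e == Hb.2) g (Some e) - g None <= 0)%R])%classic.

Let coord_continuous (i : option {set 'I_n}) : continuous (fun g : point => g i : R).
Proof. exact: (@proj_continuous _ (fun=> (R : topologicalType)) i). Qed.

Let sum_continuous (P : pred {set 'I_n}) :
  continuous (fun g : point => \sum_(e | P e) g (Some e) : R).
Proof.
by apply: continuous_big => [|e _]; [exact: add_continuous | exact: coord_continuous].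
Qed.

Let admissible_closed c : closed (admissible c).
Proof.
apply: closedI.
  have /continuous_closedP cont : continuous (fun g : point =>
      \sum_(e in edges [set: 'I_n]) g (Some e) : R) by exact: sum_continuous.
  by apply: (cont [set x : R | x = N]%classic); exact: closed_eq.
apply: closed_bigI => Hb _.
have /continuous_closedP cont : continuous (fun g : point =>
    \sum_(e in edges Hb.1 | c e == Hb.2) g (Some e) - g None : R).
  move=> g.
  have sum_g := @sum_continuous (fun e => (e \in edges Hb.1) && (c e == Hb.2)) g.
  exact: cvgB sum_g (@coord_continuous None g).
by apply: (cont [set x : R | x <= 0]%classic); exact: closed_le.
Qed.

Let bounded_points_compact : compact bounded_points.
Proof.
by apply: tychonoff => -[e|]; exact: segment_compact.
Qed.

(** Compactness for a fixed coloring: weights are at most their total [N], and [q] may be cut at 3,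
    which constant weight 1 achieves. *)
Lemma min_feasible_coloring (c : coloring n) : exists2 q : R,
  wR_feasible n q & forall w q', (forall e, e \in edges [set: 'I_n] -> 0 <= w e) ->
    \sum_(e in edges [set: 'I_n]) w e = N -> color_sum_le w c q' -> q <= q'.
Proof.
have [|||g gA gmin] := @compact_EVT_min point R (fun g => g None)
    (bounded_points `&` admissible c)%classic.
- exists (fun i => if i is Some _ then 1 else 3); split=> [[e|]|] /=.
  + by rewrite in_itv /= ler01 N_ge1.
  + by rewrite in_itv /=; lra.
  split=> /=; first by rewrite sumr_const card_edges cardsT card_ord.
  move=> [H b] /= H3; rewrite subr_le0.
  apply: le_trans (_ : \sum_(e in edges H) 1 <= _).
    by rewrite big_mkcondr; apply: ler_sum => e _; case: ifP.
  by rewrite sumr_const card_edges H3.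
- exact: compact_closedI.
- exact/continuous_subspaceT/coord_continuous.
move/set_mem: gA => -[g_box [gN gH]]; exists (g None).
  exists (fun e => g (Some e)), c; split=> //.
    by move=> e _; have := g_box (Some e); rewrite /box /= in_itv /= => /andP[].
  apply/color_sum_leP => H b H3; rewrite -subr_le0; exact: (gH (H, b)).
move=> w q' w0 wN /color_sum_leP wH; have [q'3|q'3] := leP 3 q'.
  apply: le_trans q'3; have := g_box None; rewrite /box /= in_itv /= => /andP[_].
  by [].
pose h : point := fun i =>
  if i is Some e then (if e \in edges [set: 'I_n] then w e else 0) else q'.
have hN : \sum_(e in edges [set: 'I_n]) h (Some e) = N.
  by rewrite -wN; apply: eq_bigr => e /= ->.
have feas : wR_feasible n q' by exists w, c; split=> //; apply/color_sum_leP.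
have [q'0 _] := feasible_tau n_gt2 feas.
apply: (gmin h (mem_set _)); split; [|split=> //].
- case=> [e|] /=; rewrite in_itv /=; last by rewrite ltW //= ltW.
  case: ifP => [eT|_]; last by rewrite lexx /= (le_trans ler01).
  rewrite w0 //= -wN (bigD1 e) //= lerDl sumr_ge0 // => f /andP[fT _].
  exact: w0.
- move=> [H b] /= H3; rewrite subr_le0; apply: le_trans (wH H b H3).
  apply: ler_sum => e /andP[eH _].
  by rewrite (fintype.subsetP (edges_sub H) e eH).
Qed.

(** The least of the minima over the finitely many colorings lies in the defining set, so [xget]
    does not return its default. *)
Lemma wR_spec : wR_feasible n (@wR R n) /\
  forall q : R, wR_feasible n q -> @wR R n <= q.
Proof.
have /choice[m m_spec] : forall c : coloring n, exists q : R, wR_feasible n q /\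
  forall w q', (forall e, e \in edges [set: 'I_n] -> 0 <= w e) ->
    \sum_(e in edges [set: 'I_n]) w e = N -> color_sum_le w c q' -> q <= q'.
  by move=> c; have [q q1 q2] := min_feasible_coloring c; exists q.
have [c _ cmin] := @arg_minP _ _ _ ([ffun=> true] : coloring n) xpredT m isT.
have : ([set q | wR_feasible n q] `&` lbound [set q | wR_feasible n q])%classic (m c).
  split=> /=; first exact: (m_spec c).1.
  move=> q [w [c' [w0 wN wq]]]; apply: le_trans (cmin c' isT) _.
  exact: (m_spec c').2 w0 wN wq.
by move/(xgetI 0) => [].
Qed.

End Minimum.

(** * Spreading fractional packings by sampling *)

Definition frac_packing (R : realType) n (c : coloring n) (z : {set 'I_n} -> R) :=
  [/\ forall T, 0 <= z T,
      forall T, 0 < z T -> #|T| = 3%N /\ monochromatic c T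
    & forall e, \sum_(T | e \in edges T) z T <= 1].

Lemma sum_insub (R : realType) (T : finType) (D P : pred T) (x : {t | D t} -> R) :
  \sum_(t | P t) oapp x 0 (insub t) = \sum_(u | P (val u)) x u.
Proof.
rewrite (bigID D) /= addrC big1 ?add0r; last first.
  by move=> t /andP[_ Dt]; rewrite insubN.
rewrite (reindex_omap (val : {t | D t} -> T) insub) /=; last first.
  by move=> t /andP[_ Dt]; rewrite insubT.
by apply: eq_big => [u|u _]; rewrite valK ?eqxx ?andbT // (valP u) andbT.
Qed.

Lemma dual_frac_packing (R : realType) m (c : coloring m) (beta eta : R) :
  0 <= beta -> 0 < eta <= 1 ->
  (forall y, mono_cover c y -> beta <= \sum_(e in edges [set: 'I_m]) y e) ->
  exists2 z, frac_packing c z & (1 - eta) * beta <= \sum_T z T.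
Proof.
move=> beta0 eta01 cov.
pose tri (T : {set 'I_m}) := (#|T| == 3%N) && monochromatic c T.
have inc3 (u : {T | tri T}) : #|edges (val u)| = 3%N.
  by case: u => T /= /andP[/eqP T3 _]; rewrite card_edges T3.
have [y y0 ycov|x [x0 xdeg xsum]] := approximate_duality inc3 beta0 eta01.
  apply: le_trans (cov y _) _.
    split=> // H /eqP H3 Hc; have triH : tri H by rewrite /tri H3.
    exact: (ycov (exist _ H triH)).
  by rewrite [leLHS]big_mkcond; apply: ler_sum => e _; case: ifP.
exists (fun T => oapp x 0 (insub T)); last by rewrite (sum_insub xpredT).
split=> [T|T|e].
- by case: insub.
- by case: insubP => [u /andP[/eqP T3 Tc]|] //=; rewrite ltxx.
- by rewrite (sum_insub (fun T => e \in edges T)).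
Qed.

(** With [U] the set of all edges of $K_n$, a loss of [d] per hypergraph vertex is a loss of [d] in
    density. *)
Lemma tau_coloring_nibble (R : realType) (d : R) : 0 < d ->
  exists2 eps : R, 0 < eps & forall n (c : coloring n) z,
    frac_packing c z -> (forall T, z T <= eps) ->
    \sum_T z T - d * ('C(n, 2))%:R <= (tau_coloring c)%:R.
Proof.
move=> /(@nibble R)[eps eps0 pack]; exists eps => // n c z [z0 zpos zdeg] zeps.
pose tri (T : {set 'I_n}) := (#|T| == 3%N) && monochromatic c T.
pose inc (u : {T | tri T}) := edges (val u).
have card3 (u : {T | tri T}) : #|val u| = 3%N by case: u => T /= /andP[/eqP].
have zsub (P : pred {set 'I_n}) :
    \sum_(u : {T | tri T} | P (val u)) z (val u) = \sum_(T | P T) z T.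
  rewrite -(sum_insub P (fun u : {T | tri T} => z (val u))); apply: eq_bigr => T _.
  case: insubP => [u _ <- //|ntri] /=; apply/esym/eqP; rewrite eq_le z0 andbT leNgt.
  by apply: contra ntri => /zpos[T3 Tc]; rewrite /tri T3 Tc.
have [||||| |M [_ Mdisj Mcard]] := pack {set 'I_n} {T | tri T} inc _ _
    (edges [set: 'I_n]) (fun u => z (val u)).
- by move=> u; rewrite /inc card_edges card3.
- by move=> u v uv; apply: edges_linear.
- by move=> u; apply: z0.
- by move=> u; apply: zeps.
- by move=> u _; apply: edges_sub.
- by move=> e; rewrite (zsub (fun T => e \in edges T)).
rewrite (zsub xpredT) card_edges cardsT card_ord in Mcard.
apply: le_trans Mcard _; rewrite ler_nat -(card_imset _ val_inj).
apply/tau_coloring_ge/packingP; split=> [H|H|H1 H2].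
- by case/imsetP => u _ ->.
- by case/imsetP => u _ ->; case/andP: (valP u).
- by case/imsetP => u uM -> /imsetP[v vM ->] uv; apply: Mdisj.
Qed.

Section Sampling.

Variables m n : nat.
Implicit Types (f : {ffun 'I_m -> 'I_n}) (A T : {set 'I_m}) (H e : {set 'I_n}).

Lemma count_family A (g : 'I_m -> {set 'I_n}) k : (forall i, i \in A -> #|g i| = k) ->
  (#|[set f : {ffun 'I_m -> 'I_n} | [forall i in A, f i \in g i]]| * n ^ #|A|
   = k ^ #|A| * n ^ m)%N.
Proof.
move=> gk; pose F i : pred 'I_n := [pred a | (i \in A) ==> (a \in g i)].
have -> : #|[set f : {ffun 'I_m -> 'I_n} | [forall i in A, f i \in g i]]| = #|family F|.
  by apply: eq_card => f; rewrite inE; apply/forall_inP/familyP => h i;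
    [apply/implyP/h | move/implyP: (h i)].
rewrite card_family foldrE big_map big_enum /=.
rewrite (eq_bigr (fun i => if i \in A then k else n)); last first.
  move=> i _; case: ifP => iA; last first.
    by rewrite -[RHS]card_ord; apply: eq_card => a; rewrite inE iA.
  by rewrite -(gk i iA); apply: eq_card => a; rewrite inE iA.
rewrite (bigID (mem A)) /= (eq_bigr (fun=> k)); last by move=> i ->.
rewrite prod_nat_const [X in (_ * X * _)%N](eq_bigr (fun=> n)); last first.
  by move=> i /negPf ->.
rewrite [X in (_ * X * _)%N](eq_bigl (fun i => i \in ~: A)); last by move=> i; rewrite inE.
rewrite prod_nat_const.
by rewrite -mulnA -expnD addnC cardsC card_ord.
Qed.

Lemma count_edge_image (e' : {set 'I_m}) e : #|e'| = 2%N -> #|e| = 2%N ->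
  (#|[set f : {ffun 'I_m -> 'I_n} | f @: e' == e]| * n ^ 2 <= 2 * n ^ m)%N.
Proof.
move=> e'2 e2; have /cards2P[i [j [ij e'E]]] : #|e'| == 2%N by rewrite e'2.
have /cards2P[a [b [ab eE]]] : #|e| == 2%N by rewrite e2.
pose S a b := [set f : {ffun 'I_m -> 'I_n} |
  [forall k in e', f k \in (if k == i then [set a] else [set b])]].
have cardS a' b' : (#|S a' b'| * n ^ 2 = n ^ m)%N.
  rewrite -e'2 (@count_family e' _ 1) ?exp1n ?mul1n // => k _.
  by case: ifP; rewrite cards1.
apply: leq_trans (_ : (#|S a b :|: S b a| * n ^ 2 <= _)%N).
  rewrite leq_mul2r; apply/orP; right; apply: subset_leq_card.
  apply/subsetP => f; rewrite !inE => /eqP fe.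
  have fi : f i \in [set a; b] by rewrite -eE -fe imset_f // e'E set21.
  have fj : f j \in [set a; b] by rewrite -eE -fe imset_f // e'E set22.
  have fij : f i != f j.
    apply/eqP => fij; have : #|f @: e'| = 1%N.
      by rewrite e'E imsetU !imset_set1 fij setUid cards1.
    by rewrite fe e2.
  have in_S a' b' : f i = a' -> f j = b' ->
      [forall k in e', f k \in (if k == i then [set a'] else [set b'])].
    move=> fa fb; apply/forall_inP => k; rewrite e'E => /set2P[]->.
      by rewrite eqxx inE fa.
    by rewrite eq_sym (negPf ij) inE fb.
  case/set2P: fi => fi; case/set2P: fj => fj.
  - by rewrite fi fj eqxx in fij.
  - by rewrite in_S.
  - by rewrite orbC in_S.
  - by rewrite fi fj eqxx in fij.
apply: leq_trans (_ : ((#|S a b| + #|S b a|) * n ^ 2 <= _)%N).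
  by rewrite leq_mul2r leq_card_setU orbT.
by rewrite mulnDl !cardS addnn mul2n.
Qed.

Lemma count_degenerate_edge (e' : {set 'I_m}) : #|e'| = 2%N ->
  (#|[set f : {ffun 'I_m -> 'I_n} | #|f @: e'| != 2%N]| * n <= n ^ m)%N.
Proof.
move=> e'2; have /cards2P[i [j [ij e'E]]] : #|e'| == 2%N by rewrite e'2.
pose S a := [set f : {ffun 'I_m -> 'I_n} | [forall k in e', f k \in [set a]]].
have cardS a : (#|S a| * n ^ 2 = n ^ m)%N.
  by rewrite -e'2 (@count_family e' _ 1) ?exp1n ?mul1n // => k _; rewrite cards1.
have [->|n0] := posnP n; first by rewrite muln0.
rewrite -(leq_pmul2r n0) -mulnA mulnn.
apply: leq_trans (_ : (#|\bigcup_a S a| * n ^ 2 <= _)%N).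
  rewrite leq_mul2r; apply/orP; right; apply: subset_leq_card.
  apply/subsetP => f; rewrite inE => fe.
  have fij : f i = f j.
    apply/eqP; apply: contraNT fe => fij.
    by rewrite e'E imsetU !imset_set1 cards2 fij.
  apply/bigcupP; exists (f i) => //; rewrite inE; apply/forall_inP => k.
  by rewrite e'E => /set2P[]->; rewrite inE ?fij.
apply: leq_trans (_ : ((\sum_a #|S a|) * n ^ 2 <= _)%N).
  rewrite leq_mul2r; apply/orP; right.
  elim/big_rec2: _ => [|a s S' _ le]; first by rewrite cards0.
  by rewrite (leq_trans (leq_card_setU _ _)) ?leq_add2l.
by rewrite big_distrl /= (eq_bigr (fun=> n ^ m)%N) // sum_nat_const card_ord mulnC.
Qed.

(** 27 counts all maps from [T] to [H], not just the bijections; what matters is the order n^(m -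
    3). *)
Lemma count_triangle_image T H : #|T| = 3%N -> #|H| = 3%N ->
  (#|[set f : {ffun 'I_m -> 'I_n} | f @: T == H]| * n ^ 3 <= 27 * n ^ m)%N.
Proof.
move=> T3 H3; have := @count_family T (fun=> H) 3; rewrite T3 => /(_ (fun _ _ => H3)) <-.
rewrite leq_mul2r; apply/orP; right; apply: subset_leq_card.
apply/subsetP => f; rewrite !inE => /eqP fT; apply/forall_inP => i iT.
by rewrite -fT imset_f.
Qed.

End Sampling.

(** An edge collapsed by [f] gets the meaningless color of a singleton; triangles with such an edge
    are dropped when packings are pushed forward. *)
Definition pullback m n (c : coloring n) (f : {ffun 'I_m -> 'I_n}) : coloring m :=
  [ffun A : {set 'I_m} => c (f @: A)].

Lemma triangle_image_inj m n (f : {ffun 'I_m -> 'I_n}) (T : {set 'I_m}) :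
  #|T| = 3%N -> (#|f @: T| == 3%N) = [forall e in edges T, #|f @: e| == 2%N].
Proof.
move=> T3; rewrite -{1}T3; apply/idP/forall_inP => [/imset_injP finj e eT|inj].
  rewrite -(edges_card2 eT); apply/imset_injP; apply: sub_in2 finj => i.
  by move: eT; rewrite in_edges => /andP[/fintype.subsetP sub _]; apply: sub.
apply/imset_injP => i j iT jT fij; apply/eqP; apply: contraT => ij.
have /inj : [set i; j] \in edges T.
  rewrite in_edges cards2 ij andbT; apply/fintype.subsetP => k.
  by case/set2P => ->.
by rewrite imsetU !imset_set1 fij setUid cards1.
Qed.

Lemma edge_preimage m n (f : {ffun 'I_m -> 'I_n}) (T : {set 'I_m}) (e : {set 'I_n}) :
  #|T| = 3%N -> #|f @: T| = 3%N -> e \in edges (f @: T) ->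
  exists2 e' : {set 'I_m}, e' \in edges T & f @: e' = e.
Proof.
move=> T3 fT3 efT; have /imset_injP finj : #|f @: T| == #|T| by rewrite T3 fT3.
have fe : f @: (T :&: f @^-1: e) = e.
  apply/setP => a; apply/imsetP/idP => [[i + ->]|ae]; first by rewrite !inE => /andP[].
  move: (efT); rewrite in_edges => /andP[/fintype.subsetP/(_ a ae)/imsetP[i iT ai] _].
  by exists i => //; rewrite !inE iT -ai.
exists (T :&: f @^-1: e) => //.
rewrite in_edges subsetIl -(edges_card2 efT) -{2}fe eq_sym; apply/imset_injP.
by apply: sub_in2 finj => i; rewrite inE => /andP[].
Qed.

(** Each map pulls the coloring back to $K_m$, and the triangles of its packing that stay triangles
    are pushed forward. The loss [n%:R^-1] is the chance that an edge collapses. *)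
Lemma spread_packing (R : realType) m n (c : coloring n) (b : R) :
  (2 < m)%N -> (0 < n)%N ->
  (forall c' : coloring m, exists2 z, frac_packing c' z & b <= \sum_T z T) ->
  exists X, [/\ frac_packing c X,
    forall H, X H <= 27 * ('C(m, 3))%:R / n%:R
  & n%:R ^+ 2 / 2 * (b / ('C(m, 2))%:R - n%:R^-1) <= \sum_H X H].
Proof.
move=> m3 n0 hb; set M : R := ('C(m, 2))%:R.
have /fin_all_exists[z zP] : forall f : {ffun 'I_m -> 'I_n},
    exists z, frac_packing (pullback c f) z /\ b <= \sum_T z T.
  by move=> f; have [z] := hb (pullback c f); exists z.
have z0 f T : 0 <= z f T by have [[+ _ _] _] := zP f; apply.
have zpos f T : 0 < z f T -> #|T| = 3%N /\ monochromatic (pullback c f) T.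
  by have [[_ + _] _] := zP f; apply.
have zdeg f e : \sum_(T : {set 'I_m} | e \in edges T) z f T <= 1.
  by have [[_ _ +] _] := zP f; apply.
have zb f : b <= \sum_T z f T by have [] := zP f.
have z_eq0 f (T : {set 'I_m}) : #|T| != 3%N -> z f T = 0.
  move=> T3; apply/eqP; rewrite eq_le z0 andbT leNgt.
  by apply: contra T3 => /zpos[->].
have z1 f (T : {set 'I_m}) : z f T <= 1.
  have [T3|/z_eq0->//] := eqVneq #|T| 3%N.
  have /set0Pn[e eT] : edges T != set0 by rewrite -cards_eq0 card_edges T3.
  apply: le_trans (zdeg f e); rewrite (bigD1 T) //= lerDl.
  by apply: sumr_ge0 => T' _; apply: z0.
have M1 : 1 <= M by rewrite ler1n bin_gt0 ltnW.
have nR0 : 0 < n%:R :> R by rewrite ltr0n.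
have nm0 : 0 < n%:R ^+ m :> R by rewrite exprn_gt0.
have [k kE] : exists k : R, k = n%:R ^+ 2 / (2 * M * n%:R ^+ m) by eexists.
have M0 : 0 < M by lra.
have k0 : 0 < k by rewrite kE !(divr_gt0, mulr_gt0, exprn_gt0).
(* [k] makes the load of every edge at most [1]: a fixed edge of K_m is mapped onto
   a given edge of K_n by at most [2 * n ^ (m - 2)] of the [n ^ m] maps. *)
pose X (H : {set 'I_n}) : R :=
  k * \sum_(f : {ffun 'I_m -> 'I_n})
        \sum_(T : {set 'I_m} | (f @: T == H) && (#|H| == 3%N)) z f T.
have sumX (P : pred {set 'I_n}) : \sum_(H | P H) X H =
    k * \sum_(f : {ffun 'I_m -> 'I_n})
          \sum_(T : {set 'I_m} | P (f @: T) && (#|f @: T| == 3%N)) z f T.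
  rewrite -mulr_sumr exchange_big /=; congr (_ * _); apply: eq_bigr => f _.
  rewrite (exchange_big_dep
    (fun T : {set 'I_m} => P (f @: T) && (#|f @: T| == 3%N))) /=; last first.
    by move=> H T PH /andP[/eqP-> ->]; rewrite PH.
  apply: eq_bigr => T /andP[PT T3]; rewrite (big_pred1 (f @: T)) // => H.
  by rewrite /= eq_sym; case: eqP => [->|]; rewrite ?andbF // PT T3.
exists X; split; first split=> [H|H|e].
- by rewrite mulr_ge0 ?(ltW k0) // sumr_ge0 // => f _; apply: sumr_ge0.
- move=> XH; suff [f [T [/eqP fT H3 zT]]] : exists (f : {ffun 'I_m -> 'I_n}) (T : {set 'I_m}),
      [/\ f @: T == H, #|H| == 3%N & 0 < z f T].
    split; first exact/eqP; have [T3 /monochromaticP[col hcol]] := zpos _ _ zT.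
    apply/monochromaticP; exists col => e; rewrite -fT => eH.
    have fT3 : #|f @: T| = 3%N by rewrite fT (eqP H3).
    have [e' e'T <-] := edge_preimage T3 fT3 eH.
    by rewrite -(hcol e' e'T) ffunE.
  apply: contrapT => none; move: XH; rewrite /X big1 ?mulr0 ?ltxx // => f _.
  apply: big1 => T /andP[fT H3]; apply/eqP; rewrite eq_le z0 andbT leNgt.
  by apply/negP => zT; apply: none; exists f, T.
- rewrite (sumX (fun H => e \in edges H)).
  have [e2|e2] := eqVneq #|e| 2%N; last first.
    rewrite big1 ?mulr0 ?ler01 // => f _; apply: big_pred0 => T.
    by rewrite in_edges (negPf e2) andbF.
  (* A triangle whose image contains [e] has an edge mapped onto [e], so the load of [e] is at most
     the sum of the loads, each at most 1, of its preimages. *)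
  have inner (f : {ffun 'I_m -> 'I_n}) :
      \sum_(T : {set 'I_m} | (e \in edges (f @: T)) && (#|f @: T| == 3%N)) z f T <=
      \sum_(e' in edges [set: 'I_m]) (f @: e' == e)%:R.
    apply: le_trans (_ : \sum_(e' in edges [set: 'I_m]) (f @: e' == e)%:R *
        \sum_(T : {set 'I_m} | e' \in edges T) z f T <= _); last first.
      by apply: ler_sum => e' _; rewrite ler_piMr.
    under [leRHS]eq_bigr do rewrite mulr_sumr.
    rewrite [leRHS](exchange_big_dep predT) //= big_mkcond /=; apply: ler_sum => T _.
    have s0 (P : pred {set 'I_m}) : 0 <= \sum_(e' | P e') (f @: e' == e)%:R * z f T.
      by apply: sumr_ge0 => e' _; rewrite mulr_ge0.
    case: ifP => // /andP[eT /eqP fT3].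
    have [T3|T3] := eqVneq #|T| 3%N; last by rewrite [leLHS](z_eq0 _ _ T3).
    have [e' e'T fe'] := edge_preimage T3 fT3 eT.
    rewrite (bigD1 e') /=; last first.
      by rewrite e'T in_edgesT (edges_card2 e'T).
    by rewrite fe' eqxx mul1r lerDl s0.
  apply: le_trans (_ : k * \sum_(e' in edges [set: 'I_m]) (2 * n%:R ^+ m / n%:R ^+ 2) <= _).
    rewrite ler_pM2l //; apply: le_trans (ler_sum _ (fun f _ => inner f)) _.
    rewrite exchange_big /=; apply: ler_sum => e'; rewrite in_edgesT => /eqP e'2.
    rewrite ler_pdivlMr ?exprn_gt0 // -!natrX -natrM.
    have := @count_edge_image m n e' e e'2 e2; rewrite -(ler_nat R) natrM => le.
    apply: le_trans le; rewrite ler_pM2r ?ltr0n ?expn_gt0 ?n0 //.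
    rewrite -sum1_card natr_sum big_mkcond [leRHS]big_mkcond /=.
    by apply: ler_sum => f _; rewrite inE; case: ifP.
  rewrite sumr_const card_edges cardsT card_ord -[_ *+ 'C(m, 2)]mulr_natr -/M kE.
  rewrite le_eqVlt; apply/orP; left; apply/eqP; field.
  by rewrite !gt_eqF.
- move=> H; rewrite /X; have [H3|_] := eqVneq #|H| 3%N; last first.
    rewrite big1 ?mulr0 ?divr_ge0 ?mulr_ge0 ?(ltW nR0) // => f _.
    by apply: big_pred0 => T; rewrite andbF.
  apply: le_trans (_ : k * \sum_(T : {set 'I_m} | #|T| == 3%N)
      (27 * n%:R ^+ m / n%:R ^+ 3) <= _).
    rewrite ler_pM2l //.
    apply: le_trans (_ : \sum_(f : {ffun 'I_m -> 'I_n})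
        \sum_(T : {set 'I_m} | #|T| == 3%N) (f @: T == H)%:R <= _).
      apply: ler_sum => f _; rewrite big_mkcond [leRHS]big_mkcond /=.
      apply: ler_sum => T _; rewrite andbT.
      by have [T3|/z_eq0->] := eqVneq #|T| 3%N; case: eqVneq.
    rewrite exchange_big /=; apply: ler_sum => T /eqP T3.
    rewrite ler_pdivlMr ?exprn_gt0 // -!natrX -natrM.
    have := @count_triangle_image m n T H T3 H3; rewrite -(ler_nat R) natrM => le.
    apply: le_trans le; rewrite ler_pM2r ?ltr0n ?expn_gt0 ?n0 //.
    rewrite -sum1_card natr_sum big_mkcond [leRHS]big_mkcond /=.
    by apply: ler_sum => f _; rewrite inE; case: ifP.
  rewrite sumr_const (_ : #|_| = 'C(m, 3)); last first.
    rewrite -[m in RHS]card_ord -cardsT -cards_draws.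
    by apply: eq_card => T; rewrite !inE finset.subsetT.
  rewrite -[_ *+ 'C(m, 3)]mulr_natr kE.
  have -> : n%:R ^+ 2 / (2 * M * n%:R ^+ m) *
      (27 * n%:R ^+ m / n%:R ^+ 3 * 'C(m, 3)%:R)
     = (27 * 'C(m, 3)%:R / n%:R) / (2 * M) :> R.
    by field; rewrite !gt_eqF.
  rewrite ler_pdivrMr ?mulr_gt0 // ler_peMr ?divr_ge0 ?mulr_ge0 ?(ltW nR0) //.
  by lra.
rewrite (sumX xpredT).
(* A triangle that degenerates has a collapsed edge, and the load of each collapsed edge is at most
   1. *)
have inner (f : {ffun 'I_m -> 'I_n}) :
    b - \sum_(e' in edges [set: 'I_m]) (#|f @: e'| != 2%N)%:R <=
    \sum_(T : {set 'I_m} | #|f @: T| == 3%N) z f T.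
  rewrite lerBlDr; apply: le_trans (zb f) _.
  rewrite (bigID (fun T : {set 'I_m} => #|f @: T| == 3%N)) /= lerD2l.
  apply: le_trans (_ : \sum_(e' in edges [set: 'I_m]) (#|f @: e'| != 2%N)%:R *
      \sum_(T : {set 'I_m} | e' \in edges T) z f T <= _); last first.
    by apply: ler_sum => e' _; rewrite ler_piMr.
  under [leRHS]eq_bigr do rewrite mulr_sumr.
  rewrite [leRHS](exchange_big_dep predT) //= big_mkcond /=; apply: ler_sum => T _.
  have s0 (P : pred {set 'I_m}) :
      0 <= \sum_(e' | P e') (#|f @: e'| != 2%N)%:R * z f T.
    by apply: sumr_ge0 => e' _; rewrite mulr_ge0.
  case: ifP => // fT3.
  have [T3|T3] := eqVneq #|T| 3%N; last by rewrite [leLHS](z_eq0 _ _ T3).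
  move: fT3; rewrite triangle_image_inj // => /forall_inPn[e' e'T fe'].
  rewrite (bigD1 e') /=; last first.
    by rewrite e'T in_edgesT (edges_card2 e'T).
  by rewrite fe' mul1r lerDl s0.
have deg : \sum_(f : {ffun 'I_m -> 'I_n}) \sum_(e' in edges [set: 'I_m])
    (#|f @: e'| != 2%N)%:R <= M * (n%:R ^+ m / n%:R) :> R.
  have -> : M * (n%:R ^+ m / n%:R) =
      \sum_(e' in edges [set: 'I_m]) (n%:R ^+ m / n%:R).
    by rewrite sumr_const card_edges cardsT card_ord mulr_natl.
  rewrite exchange_big /=.
  apply: ler_sum => e'; rewrite in_edgesT => /eqP e'2.
  rewrite ler_pdivlMr // -!natrX.
  have := @count_degenerate_edge m n e' e'2; rewrite -(ler_nat R) natrM => le.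
  apply: le_trans le; rewrite ler_pM2r //.
  rewrite -sum1_card natr_sum big_mkcond [leRHS]big_mkcond /=.
  by apply: ler_sum => f _; rewrite inE; case: ifP.
have total : n%:R ^+ m * b - M * (n%:R ^+ m / n%:R) <=
    \sum_(f : {ffun 'I_m -> 'I_n}) \sum_(T : {set 'I_m} | #|f @: T| == 3%N) z f T.
  apply: le_trans (ler_sum _ (fun f _ => inner f)).
  have sum_b : \sum_(f : {ffun 'I_m -> 'I_n}) b = n%:R ^+ m * b.
    by rewrite sumr_const card_ffun !card_ord -natrX mulr_natl.
  by rewrite sumrB sum_b lerD2l lerN2.
apply: le_trans (_ : k * (n%:R ^+ m * b - M * (n%:R ^+ m / n%:R)) <= _); last first.
  by rewrite ler_pM2l.
rewrite kE le_eqVlt; apply/orP; left; apply/eqP; field.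
by rewrite !gt_eqF.
Qed.

(** * The limits *)

Section Limits.

Variable R : realType.

Lemma binomial2E n : 2 * ('C(n, 2))%:R = n%:R * (n%:R - 1) :> R.
Proof.
case: n => [|n]; first by rewrite bin0n mulr0 mul0r.
rewrite -natrM mulnC (_ : 2%N = 2`!) // bin_ffact ffactnS ffactn1 natrM.
by rewrite -[n.+1%:R]natr1 addrK.
Qed.

Lemma wR_gt0 n : (2 < n)%N -> 0 < @wR R n.
Proof. by move=> n3; have [/(feasible_tau n3)[]] := wR_spec R n3. Qed.

Lemma wR_le3 n : (2 < n)%N -> @wR R n <= 3.
Proof.
move=> n3; apply: (wR_spec R n3).2; exists (fun=> 1), [ffun=> true]; split=> //.
  by rewrite sumr_const card_edges cardsT card_ord.
apply/color_sum_leP => H b H3; apply: le_trans (_ : \sum_(e in edges H) 1 <= _).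
  by rewrite big_mkcondr; apply: ler_sum => e _; case: ifP.
by rewrite sumr_const card_edges H3.
Qed.

Lemma tau_density_le n : (2 < n)%N ->
  @tau_density R n <= 1 - 2 / @wR R n + 4 / n%:R.
Proof.
move=> n3; have [feas _] := wR_spec R n3; have [q0 le] := feasible_tau n3 feas.
have C0 : 0 < ('C(n, 2))%:R :> R by rewrite ltr0n bin_gt0 ltnW.
have n0 : 0 < n%:R :> R by rewrite ltr0n ltnW // ltnW.
rewrite /tau_density ler_pdivrMr //; apply: le_trans le _.
rewrite [leRHS]mulrDl mulrBl mul1r lerD2l mulrAC ler_pdivlMr //.
(* The error n / C(n, 2) = 2 / (n - 1) is at most 4 / n. *)
have := binomial2E n; have : 2 <= n%:R :> R by rewrite ler_nat ltnW.
by nra.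
Qed.

(** Minimality of [wR] against the weighting built from the cover, solved for the total of [y]. *)
Lemma cover_ge m (c : coloring m) y : (2 < m)%N -> mono_cover c y ->
  (1 - 2 / @wR R m) * ('C(m, 2))%:R <= \sum_(e in edges [set: 'I_m]) y e.
Proof.
move=> m3 cov; have q0 := wR_gt0 m3.
have C0 : 0 < ('C(m, 2))%:R :> R by rewrite ltr0n bin_gt0 ltnW.
set Y := \sum_(e in _) _; have iq0 : 0 < 2 / wR R m by rewrite divr_gt0.
have [YC|CY] := ltP Y ('C(m, 2))%:R; last first.
  by apply: le_trans CY; rewrite ler_piMl // gerBl ltW.
have := (wR_spec R m3).2 _ (cover_feasible m3 cov YC); rewrite -/Y.
rewrite ler_pdivlMr ?subr_gt0 // => le.
rewrite mulrBl mul1r lerBlDr -lerBlDl mulrAC ler_pdivlMr // mulrC.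
exact: le.
Qed.

Lemma tau_density_ge m (eta : R) : (2 < m)%N -> 0 < eta ->
  exists N, forall n, (N <= n)%N -> 1 - 2 / @wR R m - eta <= @tau_density R n.
Proof.
move=> m3 eta0; set beta := 1 - 2 / _.
have t0 n : 0 <= @tau_density R n by rewrite divr_ge0.
have [beta_le|beta_gt] := leP beta eta.
  by exists 0%N => n _; apply: le_trans (t0 n); rewrite subr_le0.
have q0 := wR_gt0 m3; have iq0 : 0 < 2 / wR R m by rewrite divr_gt0.
have beta1 : beta <= 1 by rewrite /beta gerBl ltW.
have C0 : 0 < ('C(m, 2))%:R :> R by rewrite ltr0n bin_gt0 ltnW.
have packing (c : coloring m) : exists2 z : _ -> R, frac_packing c z &
    (1 - eta / 3) * (beta * ('C(m, 2))%:R) <= \sum_T z T.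
  apply: dual_frac_packing => [||y cov]; last exact: cover_ge m3 cov.
    by rewrite mulr_ge0 //; lra.
  by apply/andP; split; lra.
have [|eps eps0 nib] := @tau_coloring_nibble R (eta / 3); first by lra.
(* The first summand brings the spread weights below [eps], the second brings 1/n below [eta / 3];
   duality and the nibble cost [eta / 3] each. *)
pose K : R := 27 * ('C(m, 3))%:R / eps + 3 / eta.
have K1 : 0 <= 27 * ('C(m, 3))%:R / eps by rewrite divr_ge0 ?mulr_ge0 // ltW.
have K2 : 0 < 3 / eta by rewrite divr_gt0.
exists (maxn 3 (Num.bound K)) => n; rewrite geq_max => /andP[n3 Kn].
have {}Kn : K <= n%:R.
  apply: le_trans (_ : (Num.bound K)%:R <= _); last by rewrite ler_nat.
  by apply/ltW/archi_boundP; rewrite addr_ge0 // ltW.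
have n0 : 0 < n%:R :> R by rewrite ltr0n ltnW // ltnW.
have Cn0 : 0 < ('C(n, 2))%:R :> R by rewrite ltr0n bin_gt0 ltnW.
have [c ->] : exists c : coloring n, @tau_density R n = (tau_coloring c)%:R / ('C(n, 2))%:R.
  by have [c cE] := tau_attained n; exists c; rewrite /tau_density cE.
have [|X [Xpack Xle Xsum]] := spread_packing c m3 _ packing; first by rewrite ltnW // ltnW.
have {}nib := nib n c X Xpack.
rewrite ler_pdivlMr //; apply: le_trans (nib _); last first.
  move=> T; apply: le_trans (Xle T) _; rewrite ler_pdivrMr //.
  by rewrite [leRHS]mulrC -ler_pdivrMr //; move: Kn; rewrite /K; lra.
rewrite lerBrDr; apply: le_trans Xsum; rewrite mulrA mulfK ?gt_eqF //.
have n_inv : n%:R^-1 <= eta / 3.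
  rewrite -[leRHS]invrK lef_pV2 ?posrE ?invr_gt0 ?divr_gt0 // invf_div.
  by move: Kn; rewrite /K; lra.
rewrite -mulrDl mulrC.
have beta_eta : eta / 3 * beta <= eta / 3 by rewrite ler_piMr // ltW // divr_gt0.
have n2 : ('C(n, 2))%:R <= n%:R ^+ 2 / 2 :> R.
  by have := binomial2E n; rewrite expr2; lra.
by apply: ler_pM; lra.
Qed.

Let b n : R := 1 - 2 / @wR R n.
Let values : set R := [set b m | m in [set m | (2 < m)%N]]%classic.

(** This keeps [1 - B] away from 0, so that the limit of [wR] can be taken through the inverse. *)
Lemma b_le n : (2 < n)%N -> b n <= 1 / 3.
Proof.
move=> n3; have q0 := wR_gt0 n3; have q3 := wR_le3 n3.
have : 2 / 3 <= 2 / @wR R n by rewrite ler_pM2l // lef_pV2 ?posrE.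
by rewrite /b; lra.
Qed.

Let values_sup : has_sup values.
Proof.
split; first by exists (b 3), 3%N.
by exists (1 / 3) => _ [n n3 <-]; exact: b_le.
Qed.

Let B := sup values.

Let B_le : B <= 1 / 3.
Proof. by apply: ge_sup => [|_ [n n3 <-]]; [exists (b 3), 3%N | exact: b_le]. Qed.

Let b_leB n : (2 < n)%N -> b n <= B.
Proof. by move=> n3; apply: ub_le_sup; [case: values_sup | exists n]. Qed.

(** [tau_density] links the values of [b] at different indices: for a fixed [m] with [b m] near the
    supremum it is eventually at least [b m] minus a little, and at [n] it is at most
    [b n + 4 / n%:R]. Hence [b n] is near [B] too. *)
Let squeeze (eps : R) : 0 < eps -> exists N, forall n, (N <= n)%N ->
  [/\ B - eps <= @tau_density R n, @tau_density R n <= B + eps,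
      B - eps <= b n & b n <= B].
Proof.
move=> eps0; have eps2 : 0 < eps / 4 by lra.
have [_ [m m3 <-] bm] := sup_adherent eps2 values_sup.
have [N hN] := tau_density_ge m3 eps2.
exists (maxn N (maxn 3 (Num.bound (8 / eps)))) => n.
rewrite !geq_max => /and3P[/hN le_t n3 le_n].
have {}le_n : 8 / eps <= n%:R.
  apply: le_trans (_ : (Num.bound (8 / eps))%:R <= _); last by rewrite ler_nat.
  by apply/ltW/archi_boundP; rewrite divr_ge0 // ltW.
have n0 : 0 < n%:R :> R by rewrite ltr0n ltnW // ltnW.
have n4 : 4 / n%:R <= eps / 2.
  rewrite ler_pdivrMr //; rewrite ler_pdivrMr // in le_n; lra.
have := tau_density_le n3; have := b_leB n3; rewrite -/(b n) -/(b m) -/B in bm le_t *.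
by move=> h1 h2; split; lra.
Qed.

Lemma b_cvg : (b @ \oo --> B)%classic.
Proof.
apply/cvgrPdist_le => e e0; have [N hN] := squeeze e0.
near=> n; have [_ _ h1 h2] : [/\ B - e <= @tau_density R n, @tau_density R n <= B + e,
      B - e <= b n & b n <= B] by apply: hN; near: n; exact: nbhs_infty_ge.
by rewrite ler_norml; apply/andP; split; lra.
Unshelve. all: by end_near. Qed.

Lemma tau_density_cvg : (@tau_density R @ \oo --> B)%classic.
Proof.
apply/cvgrPdist_le => e e0; have [N hN] := squeeze e0.
near=> n; have [h1 h2 _ _] : [/\ B - e <= @tau_density R n, @tau_density R n <= B + e,
      B - e <= b n & b n <= B] by apply: hN; near: n; exact: nbhs_infty_ge.
by rewrite ler_norml; apply/andP; split; lra.
Unshelve. all: by end_near. Qed.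

Lemma wR_cvg : (@wR R @ \oo --> 2 / (1 - B))%classic.
Proof.
(* Valid also where [wR] has its junk value 0, as division by 0 gives 0. *)
have -> : @wR R = (fun n => 2 / (1 - b n)).
  by apply/funext => n; rewrite /b subKr invf_div mulrCA divff ?mulr1.
apply: cvgM; first exact: cvg_cst.
apply: cvgV; first by rewrite gt_eqF // subr_gt0; apply: le_lt_trans B_le _; lra.
by apply: cvgB; [exact: cvg_cst | exact: b_cvg].
Qed.

End Limits.

Theorem corollary1 (R : realType) :
  [/\ cvgn (@wR R), cvgn (@tau_density R) & W3 R = 2 / (1 - tau3 R)].
Proof.
have wR_lim := @wR_cvg R; have tau_lim := @tau_density_cvg R.
split; [exact: cvgP wR_lim | exact: cvgP tau_lim |].
by rewrite /W3 /tau3 (cvg_lim _ wR_lim) // (cvg_lim _ tau_lim).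
Qed.
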